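(* Let $G$ be a locally compact group and $1<p<\infty$. Let $B_p(G)$ be the Banach algebra of pointwise multipliers of the Herz algebra $A_p(G)$. If the dual space $B_p(G)^*$ is (norm) separable, then $G$ is discrete.
   Context: For $1<p<\infty$ and $\frac1p+\frac1q=1$, the Herz algebra $A_p(G)$ is the space of functions $u=\sum_{i=1}^\infty g_i*f_i^{\vee}$ with $f_i\in L^p(G)$, $g_i\in L^q(G)$, $\sum_i\|f_i\|_p\|g_i\|_q<\infty$, where $f^\vee(x)=f(x^{-1})$ and convolution is with respect to a left Haar measure; it is a commutative Banach algebra under pointwise multiplication with norm $\|u\|_{A_p}=\inf\sum_i\|f_i\|_p\|g_i\|_q$ over all such representations. $B_p(G)$ is the set of bounded continuous functions $u$ on $G$ with $uv\in A_p(G)$ for all $v\in A_p(G)$, normed by $\|u\|=\sup\{\|uv\|_{A_p}:\|v\|_{A_p}\le 1\}$. *)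

(* Defs.v *)
From HB Require Import structures.
From mathcomp Require Import all_boot all_order all_algebra.
From mathcomp Require Import all_classical all_reals all_analysis.
From mathcomp Require Import complex.

Set Implicit Arguments.
Unset Strict Implicit.
Unset Printing Implicit Defensive.

Import Order.TTheory GRing.Theory Num.Theory.
Import numFieldTopology.Exports numFieldNormedType.Exports.

Local Open Scope classical_set_scope.
Local Open Scope ring_scope.

Definition is_group {G : Type} (mul : G -> G -> G) (inv : G -> G) (e : G) :=
  [/\ forall x y z, mul x (mul y z) = mul (mul x y) z,
      forall x, mul e x = x,
      forall x, mul x e = x,
      forall x, mul (inv x) x = e
    & forall x, mul x (inv x) = e].

Definition locally_compact_group (G : ptopologicalType)
    (mul : G -> G -> G) (inv : G -> G) (e : G) :=
  [/\ is_group mul inv e,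
      continuous (fun xy : G * G => mul xy.1 xy.2),
      continuous inv,
      hausdorff_space G
    & locally_compact [set: G]].

Notation borel G := (g_sigma_algebraType (@open G)).

Definition left_haar_measure (R : realType) (G : ptopologicalType)
    (mul : G -> G -> G) (mu : {measure set (borel G) -> \bar R}) :=
  [/\ (forall (x : G) (A : set (borel G)), measurable A ->
         mu [set mul x a | a in A] = mu A),
      (forall K : set G, compact K -> (mu K < +oo)%E),
      (forall U : set G, open U -> U !=set0 -> (0 < mu U)%E),
      (forall A : set (borel G), measurable A ->
         mu A = ereal_inf [set mu U | U in [set U : set G | open U /\ A `<=` U]])
    & (forall U : set G, open U ->
         mu U = ereal_sup [set mu K | K in [set K : set G | compact K /\ K `<=` U]])].

Definition cabs (R : realType) (z : R[i]) : R :=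
  Num.sqrt (complex.Re z ^+ 2 + complex.Im z ^+ 2).

Section Herz.
Variables (R : realType) (G : ptopologicalType).
Variables (mul : G -> G -> G) (inv : G -> G).
Variable (mu : {measure set (borel G) -> \bar R}).

Definition cmeasurable (f : G -> R[i]) :=
  measurable_fun [set: borel G] (fun x : borel G => complex.Re (f x)) /\
  measurable_fun [set: borel G] (fun x : borel G => complex.Im (f x)).

Definition Lpnorm (p : R) (f : G -> R[i]) : \bar R :=
  Lnorm mu p%:E (fun x : borel G => (cabs (f x))%:E).

Definition inLp (p : R) (f : G -> R[i]) :=
  cmeasurable f /\ (Lpnorm p f < +oo)%E.

Definition cintegral (h : G -> R[i]) : R[i] :=
  (Rintegral mu [set: borel G] (fun x : borel G => complex.Re (h x)) +i*
   Rintegral mu [set: borel G] (fun x : borel G => complex.Im (h x)))%C.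

Definition fvee (f : G -> R[i]) : G -> R[i] := fun x => f (inv x).

Definition conv (g h : G -> R[i]) : G -> R[i] :=
  fun x => cintegral (fun y => g y * h (mul (inv y) x)).

Definition conj_exp (p : R) : R := p / (p - 1).

Definition Ap_rep (p : R) (u : G -> R[i]) (fs gs : nat -> G -> R[i]) :=
  [/\ (forall i, inLp p (fs i)),
      (forall i, inLp (conj_exp p) (gs i)),
      cvg (series (fun i => fine (Lpnorm p (fs i)) *
                            fine (Lpnorm (conj_exp p) (gs i))) @ \oo)
    & (forall x,
         series (fun i => complex.Re (conv (gs i) (fvee (fs i)) x)) @ \oo
           --> complex.Re (u x) /\
         series (fun i => complex.Im (conv (gs i) (fvee (fs i)) x)) @ \oo
           --> complex.Im (u x))].

Definition inAp (p : R) (u : G -> R[i]) :=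
  exists fs gs, Ap_rep p u fs gs.

Definition Ap_norm (p : R) (u : G -> R[i]) : R :=
  inf [set s : R | exists fs gs, Ap_rep p u fs gs /\
     s = lim (series (fun i => fine (Lpnorm p (fs i)) *
                               fine (Lpnorm (conj_exp p) (gs i))) @ \oo)].

Definition fmul (u v : G -> R[i]) : G -> R[i] := fun x => u x * v x.

Definition inBp (p : R) (u : G -> R[i]) :=
  [/\ continuous (fun x => complex.Re (u x)),
      continuous (fun x => complex.Im (u x)),
      (exists M : R, forall x, cabs (u x) <= M)
    & (forall v, inAp p v -> inAp p (fmul u v))].

Definition Bp_norm (p : R) (u : G -> R[i]) : \bar R :=
  ereal_sup [set (Ap_norm p (fmul u v))%:E |
             v in [set v | inAp p v /\ Ap_norm p v <= 1]].

Definition Bp_dual (p : R) (phi : (G -> R[i]) -> R[i]) :=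
  (forall (a b : R[i]) (u v : G -> R[i]), inBp p u -> inBp p v ->
      phi (fun x => a * u x + b * v x) = a * phi u + b * phi v) /\
  (exists C : R, forall u, inBp p u ->
      ((cabs (phi u))%:E <= C%:E * Bp_norm p u)%E).

Definition Bp_dual_dist (p : R) (phi psi : (G -> R[i]) -> R[i]) : \bar R :=
  ereal_sup [set (cabs (phi u - psi u))%:E |
             u in [set u | inBp p u /\ (Bp_norm p u <= 1)%E]].

Definition Bp_dual_separable (p : R) :=
  exists D : nat -> (G -> R[i]) -> R[i],
    (forall n, Bp_dual p (D n)) /\
    forall phi, Bp_dual p phi ->
      forall eps : R, 0 < eps -> exists n, (Bp_dual_dist p phi (D n) <= eps%:E)%E.

End Herz.

Definition discrete_group (G : ptopologicalType) := forall x : G, open [set x].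

(* Main.v *)
Require Import Defs.
From HB Require Import structures.
From mathcomp Require Import all_boot all_order all_algebra.
From mathcomp Require Import all_classical all_reals all_analysis.
From mathcomp Require Import complex.
From mathcomp Require Import measurable_realfun ring lra.

(** Evaluations at points belong to the dual of [B_p], and two distinct ones are at
distance at least 1/16. A separable dual therefore forces [G] to be countable, so
points have positive Haar measure, and outer regularity makes them open.

To separate [x] from [y], take a compact neighbourhood [V] of the identity and a
smoothed indicator [a] of [V] with small support, and put
[w z = \int_(xV) a (z^-1 t) dt = \int_(s^-1 xV) a (z^-1 s t) dt] for every [s].
Cutting the [t]-space into cells adapted to finer and finer oscillations of [a]
turns the last integral into a sum [\sum_k A_k (z^-1 s) K_k s] with
[\sum_k A_k^p] and [\sum_k K_k^q] controlled by the measure of [V]. If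
[v = \sum_i g_i * f_i^\vee], then [w v = \sum_(i, k) (K_k g_i) * (A_k f_i)^\vee], and
Hoelder's inequality bounds the norm of [w] as a multiplier by a constant times
[mu V], independently of [x], [y] and [V], while [w x = mu V] and [w y = 0]. *)

Set Implicit Arguments.
Unset Strict Implicit.
Unset Printing Implicit Defensive.

Import Order.TTheory GRing.Theory Num.Theory.
Import numFieldTopology.Exports numFieldNormedType.Exports.

Local Open Scope classical_set_scope.
Local Open Scope ring_scope.

(** * Series *)

(** The function [w] is the convolution of the indicator of [xV] with the reflection of [a], so its
    [A_p] norm is at most a constant times [mu V], and the multiplier bound is an instance of Herz's
    theorem that [A_p] is a Banach algebra. The classical argument (Fell absorption) writes [w v] as
    an integral over [t] of convolutions. Two obstacles shape its discrete form here. [Ap_rep]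
    admits only countable sums, and [G] may fail to be sigma-compact, so no countable family of
    small cells need cover it. But a function in L^q vanishes almost everywhere off a sigma-compact
    set, so the factorization is required only over countably many compact sets of [y] at a time,
    and countably many cells suffice. A step approximation of [a] on cells would only be
    approximate; a telescoping sum over finer and finer levels makes it exact. The increment at
    level [n] is of order [4^-n], split as [2^-n * 2^-n] between the two factors, so that the l^p
    and the l^q sum both converge geometrically. *)

Lemma exists_nat_pair_bij : exists e : nat -> nat * nat, set_bij setT setT e.
Proof.
have /card_set_bijP[f fb] : ([set: nat] #= [set: nat * nat])%card.
  by rewrite card_eq_sym; exact: card_nat2.
by exists f.
Qed.

Section series.
Context {R : realType}.
Implicit Types (a f g : nat -> R).

Lemma cvg_nnseriesP a (l : R) : (forall n, 0 <= a n) ->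
  series a @ \oo --> l <-> (\sum_(i <oo) (a i)%:E = l%:E)%E.
Proof.
move=> a0; split=> [al|al].
- have -> : (\sum_(i <oo) (a i)%:E)%E = limn (EFin \o series a).
    by congr (limn _); apply/funext => n /=; rewrite /series /= sumEFin.
  by rewrite EFin_lim ?(cvg_lim _ al)//; apply/cvg_ex; exists l.
- have ca : cvgn (series a).
    by apply: nnseries_is_cvg => //; rewrite al ltry.
  suff : limn (series a) = l by move=> <-.
  apply: EFin_inj; rewrite -al -EFin_lim//.
  by congr (limn _); apply/funext => n /=; rewrite /series /= sumEFin.
Qed.

(** Unordered sums ([esum]) can be reindexed and iterated freely; both sides are the same unordered
    sum over pairs. *)
Lemma nneseries_pair (e : nat -> nat * nat) (f : nat -> nat -> \bar R) :
  set_bij setT setT e -> (forall i k, 0 <= f i k)%E ->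
  (\sum_(N <oo) f (e N).1 (e N).2 = \sum_(i <oo) \sum_(k <oo) f i k)%E.
Proof.
move=> be f0; rewrite nneseries_esumT//.
rewrite -(@reindex_esum R _ _ setT setT e (fun x => f x.1 x.2) be).
rewrite nneseries_esumT; last by move=> i; exact: nneseries_ge0.
rewrite (eq_esum (b := fun i => \esum_(k in setT) f i k)%E); last first.
  by move=> i _; rewrite nneseries_esumT.
rewrite esum_esum//; congr esum.
by apply/seteqP; split.
Qed.

Let series_pair_ge0 (e : nat -> nat * nat) (h : nat -> nat -> R) :
  set_bij setT setT e -> (forall i k, 0 <= h i k) ->
  (\sum_(i <oo) \sum_(k <oo) (h i k)%:E < +oo)%E ->
  exists c l, [/\ forall i, series (h i) @ \oo --> c i, series c @ \oo --> (l : R) &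
    series (fun N => h (e N).1 (e N).2) @ \oo --> l].
Proof.
move=> be h0 hoo.
pose s i := (\sum_(k <oo) (h i k)%:E)%E.
have s0 i : (0 <= s i)%E by apply: nneseries_ge0 => k _ _; rewrite lee_fin.
have sfin i : s i \is a fin_num.
  rewrite ge0_fin_numE//; apply: le_lt_trans hoo.
  apply: le_trans (nneseries_lim_ge i.+1 _) => [|k _ _]; last exact: s0.
  by rewrite big_nat_recr//= leeDr// sume_ge0// => k _; exact: s0.
pose t := (\sum_(i <oo) s i)%E.
have t0 : (0 <= t)%E by apply: nneseries_ge0 => k _ _.
have tfin : t \is a fin_num by rewrite ge0_fin_numE.
exists (fine \o s), (fine t); split.
- by move=> i; apply/cvg_nnseriesP => //=; rewrite fineK.
- apply/cvg_nnseriesP => [i|]; first exact: fine_ge0.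
  by rewrite fineK//; apply: eq_eseriesr => i _ /=; rewrite fineK.
- apply/cvg_nnseriesP => // ; rewrite fineK//.
  by rewrite (nneseries_pair (f := fun i k => (h i k)%:E) be)// => i k; rewrite lee_fin.
Qed.

(** A signed family is the difference of the nonnegative families [h + |h|] and [|h|], both of
    finite total, which reduces the claim to the nonnegative case. *)
Lemma series_pair (e : nat -> nat * nat) (h : nat -> nat -> R) c (l : R) :
  set_bij setT setT e ->
  (\sum_(i <oo) \sum_(k <oo) `|h i k|%:E < +oo)%E ->
  (forall i, series (h i) @ \oo --> c i) -> series c @ \oo --> l ->
  series (fun N => h (e N).1 (e N).2) @ \oo --> l.
Proof.
move=> be hoo hc cl.
have [cg [lg [hg1 hg2 hg3]]] :=
  series_pair_ge0 be (h := fun i k => `|h i k|) (fun _ _ => normr_ge0 _) hoo.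
have f0 i k : 0 <= h i k + `|h i k|.
  by rewrite addrC -lerBlDr sub0r -normrN ler_norm.
have foo : (\sum_(i <oo) \sum_(k <oo) (h i k + `|h i k|)%:E < +oo)%E.
  apply: (@le_lt_trans _ _ (\sum_(i <oo) \sum_(k <oo) (`|h i k|%:E + `|h i k|%:E))%E).
    apply: lee_nneseries => [i _ _|i _].
      by apply: nneseries_ge0 => k _ _; rewrite lee_fin.
    apply: lee_nneseries => [k _ _|k _]; first by rewrite lee_fin.
    by rewrite -EFinD lee_fin lerD2r ler_norm.
  rewrite (eq_eseriesr (g := fun i => (\sum_(k <oo) `|h i k|%:E + \sum_(k <oo) `|h i k|%:E)%E)).
    rewrite nneseriesD ?lte_add_pinfty//.
      by move=> i _ _; apply: nneseries_ge0 => k _ _; rewrite lee_fin.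
    by move=> i _ _; apply: nneseries_ge0 => k _ _; rewrite lee_fin.
  by move=> i _; rewrite nneseriesD// => k _ _; rewrite lee_fin.
have [cf [lf [hf1 hf2 hf3]]] := series_pair_ge0 be f0 foo.
have cfE i : cf i = c i + cg i.
  apply: (cvg_unique _ (hf1 i)) => //.
  rewrite (_ : series _ = series (h i) \+ series (fun k => `|h i k|)); last first.
    by apply/funext => n; rewrite /series /= big_split.
  exact: cvgD.
have lfE : lf = l + lg.
  apply: (cvg_unique _ hf2) => //.
  rewrite (_ : series _ = series c \+ series cg); last first.
    by apply/funext => n; rewrite /series /= -big_split; apply: eq_bigr.
  exact: cvgD.
have -> : l = lf - lg by rewrite lfE addrK.
rewrite (_ : series _ = series (fun N => h (e N).1 (e N).2 + `|h (e N).1 (e N).2|) \-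
   series (fun N => `|h (e N).1 (e N).2|)); last first.
  by apply/funext => n; rewrite /series /= big_split /= addrK.
exact: cvgB.
Qed.

(** Hoelder's inequality for the counting measure, with upper bounds [F] and [G] in place of norms:
    the estimates on the two factors arrive as bounds on power sums. *)
Lemma hoelder_nneseries (p q F G : R) a b :
  0 < p -> 0 < q -> p^-1 + q^-1 = 1 -> 0 <= F -> 0 <= G ->
  (forall n, 0 <= a n) -> (forall n, 0 <= b n) ->
  (\sum_(k <oo) (a k `^ p)%:E <= (F `^ p)%:E)%E ->
  (\sum_(k <oo) (b k `^ q)%:E <= (G `^ q)%:E)%E ->
  (\sum_(k <oo) (a k * b k)%:E <= (F * G)%:E)%E.
Proof.
move=> p0 q0 pq F0 G0 a0 b0 aF bG.
have N r (c : nat -> R) C : 0 < r -> 0 <= C -> (forall n, 0 <= c n) ->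
    (\sum_(k <oo) (c k `^ r)%:E <= (C `^ r)%:E)%E ->
    (Lnorm (@counting nat R) r%:E (EFin \o c) <= C%:E)%E.
  move=> r0 C0 c0 cC; rewrite Lnorm_counting//.
  have -> : C%:E = ((C `^ r)%:E `^ r^-1)%E.
    by rewrite -poweR_EFin -poweRrM mulfV ?gt_eqF// poweRe1// lee_fin.
  apply: gt0_ler_poweR; rewrite ?invr_ge0 ?(ltW r0) ?in_itv/= ?andbT ?leey//.
  - by rewrite nneseries_ge0// => k _ _; rewrite lee_fin powR_ge0.
  - by rewrite lee_fin powR_ge0.
  - rewrite (eq_eseriesr (g := fun k => (c k `^ r)%:E))// => k _ /=.
    by rewrite ger0_norm.
have := @hoelder _ _ R (@counting nat R) a b p q _ _ p0 q0 pq.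
move=> /(_ (fun _ _ _ => I) (fun _ _ _ => I)).
rewrite Lnorm1 ge0_integral_count//= => H.
rewrite (eq_eseriesr (g := fun k => `|(a k * b k)%:E|)%E); last first.
  by move=> k _; rewrite gee0_abs// lee_fin mulr_ge0.
apply: (le_trans H); rewrite EFinM.
by apply: lee_pmul; rewrite ?Lnorm_ge0 ?N.
Qed.

End series.

(** * Topology and Haar measure of the group *)

Section locally_compact_group.
Context {G : ptopologicalType} {mul : G -> G -> G} {inv : G -> G} {e : G}.
Hypothesis lcG : locally_compact_group mul inv e.
Local Notation "x ** y" := (mul x y) (at level 40, left associativity).

Lemma gmulA x y z : x ** (y ** z) = x ** y ** z.
Proof. by case: lcG => -[]. Qed.

Lemma gmul1 x : e ** x = x. Proof. by case: lcG => -[]. Qed.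

Lemma gmulr1 x : x ** e = x. Proof. by case: lcG => -[]. Qed.

Lemma gmulV x : inv x ** x = e. Proof. by case: lcG => -[]. Qed.

Lemma gmulrV x : x ** inv x = e. Proof. by case: lcG => -[]. Qed.

Lemma gmulK x y : inv x ** (x ** y) = y.
Proof. by rewrite gmulA gmulV gmul1. Qed.

Lemma gmulVK x y : x ** (inv x ** y) = y.
Proof. by rewrite gmulA gmulrV gmul1. Qed.

Lemma gmulI x y z : x ** y = x ** z -> y = z.
Proof. by move=> xyz; rewrite -(gmulK x y) xyz gmulK. Qed.

Lemma ginvK x : inv (inv x) = x.
Proof. by rewrite -[LHS]gmulr1 -(gmulV x) gmulA gmulV gmul1. Qed.

Lemma ginvM x y : inv (x ** y) = inv y ** inv x.
Proof. by apply: (@gmulI (x ** y)); rewrite gmulrV -gmulA gmulVK gmulrV. Qed.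

Lemma ginv1 : inv e = e.
Proof. by rewrite -[LHS]gmul1 gmulrV. Qed.

Lemma mul_cvg (T : Type) (F : set_system T) (f g : T -> G) a b : Filter F ->
  f @ F --> a -> g @ F --> b -> (fun x => f x ** g x) @ F --> a ** b.
Proof.
move=> FF fa gb; case: lcG => _ cm _ _ _.
exact: (@cvg_comp _ _ _ (fun x => (f x, g x)) (fun xy => xy.1 ** xy.2) F _ _
  (cvg_pair fa gb) (cm (a, b))).
Qed.

Lemma inv_cvg (T : Type) (F : set_system T) (f : T -> G) a : Filter F ->
  f @ F --> a -> (fun x => inv (f x)) @ F --> inv a.
Proof.
move=> FF fa; case: lcG => _ _ ci _ _.
exact: (@cvg_comp _ _ _ f inv F _ _ fa (ci a)).
Qed.

Lemma lmul_continuous x : continuous (mul x).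
Proof. by move=> y; apply: mul_cvg => //; exact: cvg_cst. Qed.

Lemma rmul_continuous x : continuous (fun y => y ** x).
Proof. by move=> y; apply: mul_cvg => //; exact: cvg_cst. Qed.

Lemma inv_continuous : continuous inv.
Proof. by case: lcG. Qed.

Lemma near_inv (P : set G) : (\forall w \near e, P w) ->
  \forall w \near e, P (inv w).
Proof. by move=> nP; apply: inv_continuous; rewrite /= ginv1. Qed.

(** Tube lemma: continuity of the product at [(k, e)] gives a neighbourhood of [e] valid near each
    [k], and compactness makes it uniform. *)
Lemma near_rmul (K U : set G) : compact K -> open U -> K `<=` U ->
  \forall w \near e, forall k, K k -> U (k ** w).
Proof.
move=> /compact_near_coveringP cK oU KU.
apply: (cK _ (nbhs e) (fun w k => U (k ** w)) _) => k Kk.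
have : (fun p : G * G => p.1 ** p.2) @ (nbhs k, nbhs e) --> k ** e.
  by apply: mul_cvg; [exact: cvg_fst | exact: cvg_snd].
by apply; rewrite gmulr1; apply: open_nbhs_nbhs; split => //; exact: KU.
Qed.

Lemma near_lmul (K U : set G) : compact K -> open U -> K `<=` U ->
  \forall w \near e, forall k, K k -> U (w ** k).
Proof.
move=> /compact_near_coveringP cK oU KU.
apply: (cK _ (nbhs e) (fun w k => U (w ** k)) _) => k Kk.
have : (fun p : G * G => p.2 ** p.1) @ (nbhs k, nbhs e) --> e ** k.
  by apply: mul_cvg; [exact: cvg_snd | exact: cvg_fst].
by apply; rewrite gmul1; apply: open_nbhs_nbhs; split => //; exact: KU.
Qed.

Lemma compact_nbhs_in (x : G) (U : set G) : nbhs x U ->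
  exists V, [/\ compact V, nbhs x V & V `<=` U].
Proof.
move=> xU; case: lcG => _ _ _ hG /(_ x I); rewrite withinET => -[K xK [cK _]].
have [W xW WU] := compact_regular hG cK xK xU.
exists (K `&` closure W); split.
- by apply: compact_closedI => //; exact: closed_closure.
- by apply: filterI => //; apply: filterS xW; exact: subset_closure.
- by move=> y [_ /WU].
Qed.

Lemma compact_image2 (f : G * G -> G) (K L : set G) : continuous f ->
  compact K -> compact L -> compact [set f x | x in K `*` L].
Proof.
move=> cf cK cL; apply: continuous_compact; first exact: continuous_subspaceT.
exact: compact_setX.
Qed.

Lemma compact_translate_cover (K W : set G) : compact K -> nbhs e W ->
  exists t : nat -> G, forall k, K k -> exists i, W (inv (t i) ** k).
Proof.
rewrite compact_cover => cK eW.
have [|k Kk|D' _ KD] := cK G setT (fun x => mul (inv x) @^-1` W°).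
- move=> x _; apply: open_comp; last exact: open_interior.
  by move=> y _; exact: lmul_continuous.
- by exists k => //=; rewrite gmulV.
exists (nth e (finmap.enum_fset D')) => k /KD[x /= xD Wx].
exists (index x (finmap.enum_fset D')); rewrite nth_index//.
exact: interior_subset.
Qed.

(** The compact sets [(K n)^-1 B] are covered one by one and their sequences of centres merged; a
    countable cover of the whole of [G] may not exist. *)
Lemma sigma_compact_translate_cover (K : nat -> set G) (B W : set G) :
  (forall n, compact (K n)) -> compact B -> nbhs e W ->
  exists t : nat -> G, forall n y b, K n y -> B b ->
    exists i, W (inv (t i) ** (inv y ** b)).
Proof.
move=> cK cB eW.
have /choice[t tP] n : exists t : nat -> G, forall y b, K n y -> B b ->
    exists i, W (inv (t i) ** (inv y ** b)).
  have cf : continuous (fun p : G * G => inv p.1 ** p.2).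
    move=> p; apply: mul_cvg; last exact: cvg_snd.
    by apply: inv_cvg; exact: cvg_fst.
  have [t tP] := compact_translate_cover (compact_image2 cf (cK n) cB) eW.
  by exists t => y b Ky Bb; apply: tP; exists (y, b).
have [s [_ _ sb]] := exists_nat_pair_bij.
exists (fun N => t (s N).1 (s N).2) => n y b Ky Bb.
have [i Wi] := tP n y b Ky Bb.
have [N _ sN] := sb (n, i) I.
by exists N; rewrite sN.
Qed.

Lemma disjoint_translates (x y : G) : x <> y ->
  exists O, [/\ open O, O e & forall a b, O a -> O b -> x ** a <> y ** b].
Proof.
move=> /eqP xy; case: lcG => _ _ _ + _.
rewrite open_hausdorff => /(_ _ _ xy) [[U V] [/= xU yV] [oU oV /eqP UV]].
exists (mul x @^-1` U `&` mul y @^-1` V); split.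
- apply: openI; apply: open_comp => // z _; exact: lmul_continuous.
- by split => /=; rewrite gmulr1; apply: set_mem.
- move=> a b [Ua _] [_ Vb] xayb; suff: (U `&` V) (x ** a) by rewrite UV.
  by split => //; rewrite xayb.
Qed.

End locally_compact_group.

(** * Borel sets, invariance, and continuity of measures of translates *)

Section haar.
Context {R : realType} {G : ptopologicalType}.
Context {mul : G -> G -> G} {inv : G -> G} {e : G}.
Context {mu : {measure set (borel G) -> \bar R}}.
Hypothesis lcG : locally_compact_group mul inv e.
Hypothesis haar_mu : left_haar_measure mul mu.
Local Notation "x ** y" := (mul x y) (at level 40, left associativity).

Lemma borel_open (A : set (borel G)) : open (A : set G) -> measurable A.
Proof. by move=> oA; exact: sub_sigma_algebra. Qed.

Lemma borel_closed (A : set (borel G)) : closed (A : set G) -> measurable A.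
Proof.
move=> cA; rewrite -(setCK A); apply: measurableC; apply: borel_open.
exact: closed_openC cA.
Qed.

Lemma borel_compact (A : set (borel G)) : compact (A : set G) -> measurable A.
Proof.
by case: lcG => _ _ _ hG _ cA; apply: borel_closed; exact: compact_closed hG cA.
Qed.

Lemma continuous_borel (f : G -> R) : continuous f ->
  measurable_fun [set: borel G] (f : borel G -> R).
Proof.
move=> /continuousP cf; apply: (measurability _ (RGenOpens.measurableE R)).
move=> _ [_ [a [b ->] <-]]; rewrite setTI; apply: borel_open; apply: cf.
exact: interval_open.
Qed.

Lemma continuous_borel_self (f : G -> G) : continuous f ->
  measurable_fun [set: borel G] (f : borel G -> borel G).
Proof.
move=> /continuousP cf; 
apply: (@measurability _ _ (borel G) (borel G) setT f (@open G)) => // _ [A oA <-].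
by rewrite setTI; apply: borel_open; exact: cf.
Qed.

Lemma measurable_translate (x : G) (A : set (borel G)) :
  measurable A -> measurable (mul x @^-1` A : set (borel G)).
Proof.
move=> mA; rewrite -[X in measurable X]setTI.
exact: (continuous_borel_self (@lmul_continuous _ _ _ _ lcG x) measurableT mA).
Qed.

Lemma haar_preimage (x : G) (A : set (borel G)) :
  measurable A -> mu (mul x @^-1` A) = mu A.
Proof.
case: haar_mu => inv_mu _ _ _ _ mA; rewrite -(inv_mu (inv x) A mA).
congr (mu _); apply/seteqP; split => [y Ay|_ [y Ay <-]].
  by exists (x ** y) => //; rewrite (gmulK lcG).
by rewrite /preimage /= (gmulVK lcG).
Qed.

Let ge0_haar_integral (x : G) (f : borel G -> \bar R) :
  measurable_fun [set: borel G] f -> (forall y, 0 <= f y)%E ->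
  (\int[mu]_y f (x ** y) = \int[mu]_y f y)%E.
Proof.
move=> mf f0.
have mx := continuous_borel_self (@lmul_continuous _ _ _ _ lcG x).
have := ge0_integral_pushforward mx mu measurableT mf (fun y _ => f0 y).
rewrite preimage_setT => <-; apply: eq_measure_integral => A mA _.
exact: haar_preimage.
Qed.

Lemma haar_integral (x : G) (f : borel G -> \bar R) : measurable_fun [set: borel G] f ->
  (\int[mu]_y f (x ** y) = \int[mu]_y f y)%E.
Proof.
move=> mf; rewrite [LHS]integralE [RHS]integralE; congr (_ - _)%E.
- rewrite -[RHS](@ge0_haar_integral x f^\+%E).
  + by apply: eq_integral => y _; rewrite !funeposE.
  + exact: measurable_funepos mf.
  + by move=> y; exact: funepos_ge0.
- rewrite -[RHS](@ge0_haar_integral x f^\-%E).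
  + by apply: eq_integral => y _; rewrite !funenegE.
  + exact: measurable_funeneg mf.
  + by move=> y; exact: funeneg_ge0.
Qed.

Lemma compact_mu_fin (K : set G) : compact K -> mu K \is a fin_num.
Proof.
move=> cK; rewrite ge0_fin_numE//; case: haar_mu => _ + _ _ _; exact.
Qed.

Lemma compact_nbhs_mu_gt0 (K : set G) : compact K -> nbhs e K -> 0 < fine (mu K).
Proof.
move=> cK eK; have mK := borel_compact cK.
apply: fine_gt0; rewrite -(@ge0_fin_numE _ (mu K))// compact_mu_fin// andbT.
case: haar_mu => _ _ pos _ _.
apply: lt_le_trans (pos _ (open_interior K) _) _; first by exists e.
apply: le_measure; rewrite ?inE//; last exact: interior_subset.
by apply: borel_open; exact: open_interior.
Qed.

Lemma sub_mu_fin (A B : set (borel G)) : measurable A -> measurable B ->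
  A `<=` B -> mu B \is a fin_num -> mu A \is a fin_num.
Proof.
move=> mA mB AB; rewrite !ge0_fin_numE//; apply: le_lt_trans.
by apply: le_measure; rewrite ?inE.
Qed.

Lemma outer_open (A : set (borel G)) (eps : R) : measurable A -> (mu A < +oo)%E ->
  0 < eps -> exists U : set G, [/\ open U, A `<=` U & (mu U < mu A + eps%:E)%E].
Proof.
move=> mA Aoo eps0; case: haar_mu => _ _ _ /(_ A mA) AE _.
have Afin : mu A \is a fin_num by rewrite ge0_fin_numE.
have [|_ [U [oU AU] <-]] := @lb_ereal_inf_adherent _
  [set mu U | U in [set U : set G | open U /\ A `<=` U]] _ eps0; rewrite -AE//.
by move=> UA; exists U.
Qed.

(** Outer regularity encloses [K] in an open [U] of measure below [mu K + eps]. For [w] near [e]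
    compactness keeps [w^-1 K] inside [U], so what falls outside [K] lies in [U] minus [K]. *)
Let near_haar_setD (K : set G) (eps : R) : compact K -> 0 < eps ->
  \forall w \near e, (mu (mul w @^-1` K `\` K) <= eps%:E)%E.
Proof.
move=> cK eps0; have mK : measurable (K : set (borel G)) by exact: borel_compact.
have Kfin := compact_mu_fin cK.
have [|U [oU KU UK]] := outer_open mK _ eps0; first by rewrite ltey_eq Kfin.
have mU := borel_open oU.
have Uoo : (mu U < +oo)%E.
  by apply: (lt_le_trans UK); rewrite leey.
have : \forall w \near e, forall k, K k -> U (inv w ** k).
  exact: (near_inv lcG (near_lmul lcG cK oU KU)).
apply: filterS => w wK.
apply: (@le_trans _ _ (mu (U `\` K))).
  apply: le_measure; rewrite ?inE//.
  - by apply: measurableD => //; exact: measurable_translate.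
  - exact: measurableD.
  - by move=> y [/wK]; rewrite (gmulK lcG).
rewrite measureD// (_ : U `&` K = K); last by apply/setIidPr.
by rewrite leeBlDl// ltW.
Qed.

(** The two sets differ inside [y^-1 D], with [D] a difference of [K] and [w^-1 K]. Left invariance
    removes [y], and intersecting with [Q] only shrinks the error; hence the uniformity in both. *)
Lemma near_haar_translate (K : set G) (eps : R) : compact K -> 0 < eps ->
  \forall w \near e, forall y (Q : set (borel G)), measurable Q ->
    `|fine (mu (mul (w ** y) @^-1` K `&` Q)) - fine (mu (mul y @^-1` K `&` Q))| <= eps.
Proof.
move=> cK eps0; have mK : measurable (K : set (borel G)) by exact: borel_compact.
have near1 := near_haar_setD cK eps0.
have near2 : \forall w \near e, (mu (mul (inv w) @^-1` K `\` K) <= eps%:E)%E.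
  exact: (near_inv lcG near1).
near=> w => y Q mQ.
have mtr z : measurable (mul z @^-1` K `&` Q : set (borel G)).
  by apply: measurableI => //; exact: measurable_translate.
have fin z : mu (mul z @^-1` K `&` Q) \is a fin_num.
  apply: (@sub_mu_fin _ (mul z @^-1` K)) => //; first exact: measurable_translate.
  by rewrite haar_preimage// compact_mu_fin.
have le z1 z2 (D : set (borel G)) : measurable D -> (mu D <= eps%:E)%E ->
    (forall t, K (z1 ** t) -> ~ K (z2 ** t) -> D (y ** t)) ->
    fine (mu (mul z1 @^-1` K `&` Q)) <= fine (mu (mul z2 @^-1` K `&` Q)) + eps.
  move=> mD De sub; rewrite -lee_fin EFinD !fineK//.
  apply: (@le_trans _ _ (mu (mul z2 @^-1` K `&` Q) + mu (mul y @^-1` D))%E); last first.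
    by rewrite leeD2l// haar_preimage.
  apply: le_trans (measureU2 _ _ _) => //; last exact: measurable_translate.
  apply: le_measure; rewrite ?inE//.
    by apply: measurableU => //; exact: measurable_translate.
  move=> t [Kt Qt]; have [Kt2|Kt2] := pselect (K (z2 ** t)); first by left.
  by right; exact: sub.
have mD z : measurable (mul z @^-1` K : set (borel G)) by exact: measurable_translate.
rewrite ler_norml lerBrDl lerBlDl; apply/andP; split.
  rewrite addrC; apply: (le _ _ (K `\` mul w @^-1` K)).
  - exact: measurableD.
  (* Translating by [w] turns [K] minus [w^-1 K] into [wK] minus [K], the case of [near_haar_setD]
     for [w^-1]. *)
  - rewrite -(@haar_preimage (inv w)); last exact: measurableD.
    rewrite (_ : _ @^-1` _ = mul (inv w) @^-1` K `\` K); first by near: w.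
    by apply/seteqP; split => t; rewrite /preimage/= (gmulVK lcG).
  - by move=> t Kt; rewrite -(gmulA lcG).
rewrite lerBlDr addrC; apply: (le _ _ (mul w @^-1` K `\` K)).
- exact: measurableD.
- by near: w.
- by move=> t; rewrite -(gmulA lcG).
Unshelve. all: end_near. Qed.

Lemma right_uniform_continuous (a : G -> R) :
  (forall eps, 0 < eps -> \forall w \near e, forall s, `|a (s ** w) - a s| <= eps) ->
  continuous a.
Proof.
move=> aw s; apply/cvgrPdist_le => eps eps0.
have cs : (fun t => inv s ** t) @ s --> e.
  rewrite -(gmulV lcG s); exact: (lmul_continuous lcG).
have : \forall t \near s, forall r, `|a (r ** (inv s ** t)) - a r| <= eps.
  exact: (cs _ (aw _ eps0)).
apply: filterS => t /= /(_ s).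
by rewrite (gmulVK lcG) distrC.
Qed.

Lemma haar_translate_continuous (K : set G) (Q : set (borel G)) :
  compact K -> measurable Q -> continuous (fun y => fine (mu (mul y @^-1` K `&` Q))).
Proof.
move=> cK mQ y; apply/cvgrPdist_le => eps eps0.
have cy : (fun t => t ** inv y) @ y --> e.
  rewrite -(gmulrV lcG y); exact: (rmul_continuous lcG).
have : \forall t \near y, forall z (Q : set (borel G)), measurable Q ->
    `|fine (mu (mul (t ** inv y ** z) @^-1` K `&` Q)) -
      fine (mu (mul z @^-1` K `&` Q))| <= eps.
  exact: (cy _ (near_haar_translate cK eps0)).
apply: filterS => t /= /(_ y Q mQ).
by rewrite -(gmulA lcG) (gmulV lcG) (gmulr1 lcG) distrC.
Qed.

(** Take [a s] to be the measure of the intersection of [sW] with [VW], divided by [mu W], for a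
    small compact neighbourhood [W] of [e]. It is 1 on [V], where [sW] lies in [VW]; it vanishes off
    [V W W^-1]; and [near_haar_translate] gives the uniform continuity. *)
Lemma smooth_indicator (V U : set G) : compact V -> open U -> V `<=` U ->
  exists a : G -> R, [/\ forall s, 0 <= a s <= 1,
    forall s, V s -> a s = 1,
    forall eps, 0 < eps -> \forall w \near e, forall s, `|a (s ** w) - a s| <= eps &
    \forall w \near e, forall s, a s != 0 -> U (s ** w)].
Proof.
move=> cV oU VU.
have nU := near_rmul lcG cV oU VU.
(* Continuity at the identity yields neighbourhoods with [V N1 N3^-1 N4] inside [U]; [W] goes into
   [N1] and [N3], and [N4] is the room left for [w] in the support clause. *)
have : (fun p : G * (G * G) => p.1 ** inv p.2.1 ** p.2.2) @
    (nbhs e, (nbhs e, nbhs e)) --> e ** inv e ** e.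
  apply: (mul_cvg lcG).
    apply: (mul_cvg lcG); first exact: cvg_fst.
    apply: (inv_cvg lcG).
    exact: (@cvg_comp _ _ _ (fun p : G * (G * G) => p.2) fst _ _ _ cvg_snd cvg_fst).
  exact: (@cvg_comp _ _ _ (fun p : G * (G * G) => p.2) snd _ _ _ cvg_snd cvg_snd).
rewrite (ginv1 lcG) !(gmul1 lcG) => /(_ _ nU)[[N1 N2] [/= eN1 [[N3 N4] [/= eN3 eN4] N34]] N12].
have [W [cW eW WN]] := compact_nbhs_in lcG (filterI eN1 eN3).
have mW : measurable (W : set (borel G)) by exact: borel_compact.
have Wfin := compact_mu_fin cW.
have W0 := compact_nbhs_mu_gt0 cW eW.
pose Q : set (borel G) := [set p.1 ** p.2 | p in V `*` W].
have cQ : compact (Q : set G).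
  apply: compact_image2 => // p; apply: (mul_cvg lcG); [exact: cvg_fst | exact: cvg_snd].
have mQ := borel_compact cQ.
pose psi y := fine (mu (mul y @^-1` W `&` Q)).
exists (fun s => psi (inv s) / fine (mu W)); split.
- move=> s; rewrite divr_ge0 ?fine_ge0//= ler_pdivrMr// mul1r /psi.
  rewrite -[in leRHS](haar_preimage (inv s) mW); apply: fine_le => //.
  + apply: (@sub_mu_fin _ (mul (inv s) @^-1` W)) => //; last by rewrite haar_preimage.
      by apply: measurableI => //; exact: measurable_translate.
    exact: measurable_translate.
  + by rewrite haar_preimage.
  + by apply: measureIl => //; exact: measurable_translate.
- move=> s Vs; rewrite /psi (_ : _ `&` _ = mul (inv s) @^-1` W).
    by rewrite haar_preimage// divff// gt_eqF.
  apply/setIidPl => t Wt; exists (s, inv s ** t) => //=.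
  by rewrite (gmulVK lcG).
- move=> eps eps0.
  have epsW : 0 < eps * fine (mu W) by rewrite mulr_gt0.
  apply: filterS (near_inv lcG (near_haar_translate cW epsW)) => w /(_ _ Q mQ) wP s.
  rewrite -mulrBl normrM (ginvM lcG) [X in _ * X]gtr0_norm ?invr_gt0//.
  by rewrite ler_pdivrMr//; exact: wP.
- apply: filterS eN4 => w N4w s; apply: contra_neqP => nU'.
  rewrite /psi (_ : _ `&` _ = set0) ?measure0 ?mul0r//.
  apply/seteqP; split => // t [Wt [[v x] [Vv Wx] vx]]; apply: nU'.
  have [N1x _] := WN _ Wx; have [_ N3t] := WN _ Wt.
  (* As [t = v x], the product [v x (s^-1 t)^-1 w] collapses to [s w]. *)
  have := N12 (x, (inv s ** t, w)) (conj N1x (N34 (_, w) (conj N3t N4w))) v Vv.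
  rewrite /= (ginvM lcG) (ginvK lcG) !(gmulA lcG) vx.
  by rewrite (gmulrV lcG) (gmul1 lcG).
Qed.

End haar.

(** * Discretization of the kernel *)

Section cells.
Context {R : realType}.

Lemma nneseries_single (f : nat -> \bar R) n : (forall k, 0 <= f k)%E ->
  (forall k, k != n -> f k = 0%E) -> (\sum_(k <oo) f k = f n)%E.
Proof.
move=> f0 fn; rewrite (nneseriesD1 (n := n))// eseries0 ?adde0// => k _ /=.
exact: fn.
Qed.

Lemma nneseries_telescope (u : nat -> R) (l : R) : u 0%N = 0 ->
  (forall n, u n <= u n.+1) -> u @ \oo --> l ->
  (\sum_(n <oo) (u n.+1 - u n)%:E = l%:E)%E.
Proof.
move=> u0 ndu ul; apply/cvg_nnseriesP => [n|]; first by rewrite subr_ge0.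
rewrite (_ : series _ = u)//; apply/funext => n.
by rewrite [RHS]eq_sum_telescope u0 add0r.
Qed.

Lemma nneseries_half : (\sum_(n <oo) (2^-1 ^+ n : R)%:E = 2%:E)%E.
Proof.
apply/cvg_nnseriesP => [n|]; first by rewrite exprn_ge0.
rewrite [X in _ --> X](_ : 2 = 1 / (1 - 2^-1)); last by field.
have : `|2^-1 : R| < 1 by rewrite ger0_norm// invf_lt1// ltr1n.
move=> /(@cvg_geometric_series _ 1).
by rewrite (_ : geometric _ _ = fun n => 2^-1 ^+ n)//; apply/funext => n; rewrite /= mul1r.
Qed.

Context {T : Type} (E : nat -> nat -> set T) (e : nat -> nat * nat).
Hypothesis e_bij : set_bij setT setT e.
Hypothesis E_disj : forall n, trivIset setT (E n).

(** An index [k] codes a triple [(n, (i, j))] by two uses of the pairing [e]: block [i] of level [n]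
    and block [j] of level [n.+1]. *)
Definition cell_level k := (e k).1.
Definition cell_fst k := (e (e k).2).1.
Definition cell_snd k := (e (e k).2).2.
Definition covered := \bigcap_n \bigcup_i E n i.

(* Only points lying in a block at every level are kept: on such points the sums
   over all cells reduce to sums over levels. *)
Definition cell k := covered `&`
  (E (cell_level k) (cell_fst k) `&` E (cell_level k).+1 (cell_snd k)).

(** By disjointness [c n] is the only block of level [n] containing [t], so among the triples of
    level [n] only [(c n, c n.+1)] contributes. *)
Lemma sum_cells (F : nat -> nat -> nat -> R) (c : nat -> nat) t :
  (forall n i j, 0 <= F n i j) -> (forall n, E n (c n) t) ->
  (\sum_(k <oo) (F (cell_level k) (cell_fst k) (cell_snd k) * \1_(cell k) t)%:E =
   \sum_(n <oo) (F n (c n) (c n.+1))%:E)%E.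
Proof.
move=> F0 ct.
pose H n i j : \bar R := (F n i j * \1_(covered `&` (E n i `&` E n.+1 j)) t)%:E.
have H0 n i j : (0 <= H n i j)%E by rewrite lee_fin mulr_ge0// indicE.
rewrite (nneseries_pair (f := fun n m => H n (e m).1 (e m).2) e_bij)//.
apply: eq_eseriesr => n _.
rewrite (nneseries_pair (f := H n) e_bij)//.
have uniq m i : E m i t -> i = c m.
  by move=> Ei; apply: (E_disj (n := m)) => //; exists t.
rewrite (nneseries_single (n := c n)); last 2 first.
- by move=> i; apply: nneseries_ge0.
- move=> i ic; apply: eseries0 => j _ _; rewrite /H indicE memNset ?mulr0// => -[_ [Ei _]].
  by rewrite (uniq _ _ Ei) eqxx in ic.
rewrite (nneseries_single (n := c n.+1))//.
- rewrite /H indicE mem_set ?mulr1//; split=> [m _|]; first by exists (c m).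
  by split; exact: ct.
- move=> j jc; rewrite /H indicE memNset ?mulr0// => -[_ [_ Ej]].
  by rewrite (uniq _ _ Ej) eqxx in jc.
Qed.

Lemma sum_cells_uncovered (F : nat -> nat -> nat -> R) t : ~ covered t ->
  (\sum_(k <oo) (F (cell_level k) (cell_fst k) (cell_snd k) * \1_(cell k) t)%:E = 0)%E.
Proof.
move=> nt; apply: eseries0 => k _ _.
by rewrite indicE memNset ?mulr0// => -[].
Qed.

End cells.

Section kernel.
Context {R : realType} {G : ptopologicalType}.
Context {mul : G -> G -> G} {inv : G -> G} {e : G}.
Context {mu : {measure set (borel G) -> \bar R}}.
Hypothesis lcG : locally_compact_group mul inv e.
Hypothesis haar_mu : left_haar_measure mul mu.
Local Notation "x ** y" := (mul x y) (at level 40, left associativity).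

Context {a : G -> R} {U B : set G} {C : nat -> set G} {p q : R}.
Hypothesis p1 : 1 < p.
Hypothesis q1 : 1 < q.
Hypothesis pq : p^-1 + q^-1 = 1.
Hypothesis a01 : forall s, 0 <= a s <= 1.
Hypothesis a_unif : forall eps, 0 < eps ->
  \forall w \near e, forall s, `|a (s ** w) - a s| <= eps.
Hypothesis a_supp : \forall w \near e, forall s, a s != 0 -> U (s ** w).
Hypothesis oU : open U.
Hypothesis cB : compact B.
Hypothesis cC : forall n, compact (C n).

Let h n : R := 2^-1 ^+ n.

Let h_gt0 n : 0 < h n. Proof. by rewrite exprn_gt0. Qed.

Let h_le1 n : h n <= 1.
Proof. by rewrite exprn_ile1// invf_le1// ler1n. Qed.

Let hS n : h n.+1 = h n / 2. Proof. by rewrite /h exprS mulrC. Qed.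

Let a_continuous : continuous a := right_uniform_continuous lcG a_unif.

(** On a block of level [n] with centre [u], [a (s ** u)] is within [h n ^+ 2 / 2] of the true
    value. Subtracting [h n ^+ 2] makes the approximation a lower bound that increases with [n];
    clipping at 0 keeps it zero wherever [a (s ** u)] is. *)
Let alpha n u s := Num.max 0 (a (s ** u) - h n ^+ 2).

Let alpha_le n u s (v : R) : 0 <= v -> `|v - a (s ** u)| <= h n ^+ 2 / 2 ->
  v - 3 / 2 * h n ^+ 2 <= alpha n u s <= v.
Proof.
move=> v0; rewrite ler_norml => /andP[lev gev].
have h20 : 0 <= h n ^+ 2 by exact: sqr_ge0.
by rewrite /alpha le_max ge_max v0 /=; apply/andP; split; [apply/orP; right|]; lra.
Qed.

(** If positive, [alpha n] is at most [v - h n ^+ 2 / 2], while [alpha n.+1] is at least [v - 3/2 *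
    h n.+1 ^+ 2 = v - 3/8 * h n ^+ 2]: halving [h] is fast enough. *)
Let alphaS n u u' s (v : R) : 0 <= v ->
  `|v - a (s ** u)| <= h n ^+ 2 / 2 -> `|v - a (s ** u')| <= h n.+1 ^+ 2 / 2 ->
  alpha n u s <= alpha n.+1 u' s.
Proof.
move=> v0 vn vS; have /andP[l1 l2] := alpha_le v0 vS.
rewrite {1}/alpha ge_max; apply/andP; split; first by rewrite /alpha le_max lexx.
apply: le_trans l1; move: vn; rewrite ler_norml hS => /andP[vn1 vn2].
have h20 : 0 <= h n ^+ 2 by exact: sqr_ge0.
by rewrite expr_div_n; lra.
Qed.

(** Since [h 0 = 1] and [a <= 1], the telescoping starts at zero. *)
Let alpha0 u s : alpha 0 u s = 0.
Proof.
by apply/max_idPl; rewrite /h expr0 expr1n subr_le0; have /andP[] := a01 (s ** u).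
Qed.

(** The clipping acts only for pairs of blocks that do not meet; it makes nonnegativity
    unconditional. *)
Let delta n u u' s := Num.max 0 (alpha n.+1 u' s - alpha n u s).

Let measurable_delta n u u' :
  measurable_fun [set: borel G] (delta n u u' : borel G -> R).
Proof.
have mal m v : measurable_fun [set: borel G] (alpha m v : borel G -> R).
  apply: measurable_maxr; first exact: measurable_cst.
  apply: measurable_funB; last exact: measurable_cst.
  apply: continuous_borel => s; apply: (@continuous_comp _ _ _ (fun s => s ** v) a).
    exact: (rmul_continuous lcG).
  exact: a_continuous.
apply: measurable_maxr; first exact: measurable_cst.
exact: measurable_funB.
Qed.

(* The weights [lam] make both [delta / lam] and [lam] summable over the levels. *)
Let lam n : R := 2 * h n.

(** Along the blocks containing a point, the increments of [alpha] telescope to [a]. An increment is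
    at most [3/2 * h n ^+ 2], so division by [lam n = 2 * h n] leaves at most [h n]. As
    [h n <= 1 < p, q], the power sums are dominated by the geometric series, of sum 2; this is the 2
    in both bounds. *)
Lemma refinement_cells : exists (Q : nat -> set (borel G)) (d : nat -> G -> R) (l : nat -> R),
  [/\ forall k, measurable (Q k) /\ mu (Q k) \is a fin_num,
      forall k, (forall s, 0 <= d k s) /\ measurable_fun [set: borel G] (d k : borel G -> R),
      forall k, 0 < l k,
      forall s t, (\sum_(k <oo) ((d k s / l k) `^ p * \1_(Q k) t)%:E <=
                   (2 * \1_U (s ** t))%:E)%E &
      (forall t, (\sum_(k <oo) (l k `^ q * \1_(Q k) t)%:E <= (2 `^ q * 2)%:E)%E) /\
      forall n y b s, C n y -> B b ->
        (\sum_(k <oo) (d k s * \1_(Q k) (inv y ** b))%:E = (a (s ** (inv y ** b)))%:E)%E].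
Proof.
(* Every block lies in a translate of the compact [K0], which gives the cells finite measure. *)
have [K0 [cK0 eK0 _]] := compact_nbhs_in lcG (@filterT _ (nbhs e) _).
pose good n := [set w | K0 w /\ (forall s, a s != 0 -> U (s ** w)) /\
  forall s, `|a (s ** w) - a s| <= h n ^+ 2 / 2].
have egood n : nbhs e (good n).
  have hn : 0 < h n ^+ 2 / 2 by rewrite divr_gt0// exprn_gt0.
  by apply: filterI => //; apply: filterI => //; exact: a_unif.
have egoodo n : nbhs e (good n)° by exact: nbhs_interior.
have /choice[t tP] n : exists t : nat -> G, forall m y b, C m y -> B b ->
    exists i, (good n)° (inv (t i) ** (inv y ** b)).
  exact: (sigma_compact_translate_cover lcG cC cB (egoodo n)).
have [sg sgb] := exists_nat_pair_bij.
pose E0 n i : set (borel G) := mul (inv (t n i)) @^-1` (good n)°.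
have oE0 n i : open (E0 n i : set G).
  apply: open_comp; last exact: open_interior.
  by move=> z _; exact: (lmul_continuous lcG).
pose E n := seqDU (E0 n).
have mE n i : measurable (E n i).
  by apply: seqDU_measurable => j; apply: borel_open.
have disjE n : trivIset setT (E n) by exact: trivIset_seqDU.
have EP n i z : E n i z -> good n (inv (t n i) ** z).
  by move=> Ez; have := @subset_seqDU _ (E0 n) i z Ez; exact: interior_subset.
have Eerr n i z s : E n i z -> `|a (s ** z) - a (s ** t n i)| <= h n ^+ 2 / 2.
  move=> /EP[_ [_ /(_ (s ** t n i))]].
  by rewrite -(gmulA lcG) (gmulVK lcG).
have EU n i z s : E n i z -> a (s ** t n i) != 0 -> U (s ** z).
  move=> /EP[_ [/(_ (s ** t n i)) + _]] => /[apply].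
  by rewrite -(gmulA lcG) (gmulVK lcG).
pose D n i j s := delta n (t n i) (t n.+1 j) s.
have covP z : covered E z -> exists c, forall n, E n (c n) z.
  move=> cz; have /choice[c cE] : forall n, exists i, E n i z.
    by move=> n; have [i _ Ei] := cz n I; exists i.
  by exists c.
have D_ge0 n i j s : 0 <= D n i j s by rewrite le_max lexx.
have D_cell n i j z s : E n i z -> E n.+1 j z ->
    D n i j s = alpha n.+1 (t n.+1 j) s - alpha n (t n i) s.
  move=> Ei Ej; apply/max_idPr; rewrite subr_ge0.
  have /andP[a0 _] := a01 (s ** z).
  by apply: (alphaS a0) => //; exact: Eerr.
have D_le n i j z s : E n i z -> E n.+1 j z ->
    D n i j s / lam n <= h n * \1_U (s ** z).
  move=> Ei Ej; have /andP[a0 _] := a01 (s ** z).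
  rewrite ler_pdivrMr ?mulr_gt0//.
  have [Uz|nU] := pselect (U (s ** z)).
    rewrite indicE mem_set// mulr1 (D_cell _ _ _ _ _ Ei Ej).
    have /andP[l1 _] := alpha_le a0 (Eerr _ _ _ s Ei).
    have /andP[_ l2] := alpha_le a0 (Eerr _ _ _ s Ej).
    have h20 : 0 <= h n ^+ 2 by exact: sqr_ge0.
    by rewrite /lam mulrCA -expr2; lra.
  (* Off [U] the support condition in [good] forces the finer approximation to vanish, so the
     increment is at most 0. *)
  rewrite (D_cell _ _ _ _ _ Ei Ej) indicE memNset// mulr0 mul0r.
  have -> : alpha n.+1 (t n.+1 j) s = 0.
    apply/max_idPl; rewrite subr_le0.
    have [->|/(EU _ _ _ _ Ej)//] := eqVneq (a (s ** t n.+1 j)) 0.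
    exact: sqr_ge0.
  by rewrite sub0r oppr_le0 le_max lexx.
have nneseries_h (c : R) : 0 <= c -> (\sum_(n <oo) (c * h n)%:E = (c * 2)%:E)%E.
  move=> c0; under eq_eseriesr do rewrite EFinM.
  by rewrite nneseriesZl ?nneseries_half// => i _; rewrite lee_fin ltW.
exists (cell E sg), (fun k s => D (cell_level sg k) (cell_fst sg k) (cell_snd sg k) s),
  (fun k => lam (cell_level sg k)); split.
- move=> k; have mcell : measurable (cell E sg k).
    apply: measurableI; last exact: measurableI.
    apply: bigcapT_measurable => n; apply: bigcupT_measurable => i; exact: mE.
  split=> //.
  apply: (@sub_mu_fin _ _ _ _ (mul (inv (t (cell_level sg k) (cell_fst sg k))) @^-1` K0)) => //.
  + by apply: (measurable_translate lcG); exact: (borel_compact lcG).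
  + by move=> z [_ [/EP[]]].
  + rewrite (haar_preimage lcG haar_mu) ?(compact_mu_fin haar_mu cK0)//.
    exact: (borel_compact lcG).
- move=> k; split; first by move=> s; exact: D_ge0.
  exact: measurable_delta.
- by move=> k; rewrite mulr_gt0.
- move=> s z.
  pose F n i j := (D n i j s / lam n) `^ p.
  have [cz|ncz] := pselect (covered E z); last first.
    by rewrite (sum_cells_uncovered (E := E) sg F ncz) lee_fin mulr_ge0// indicE.
  have [c cE] := covP _ cz.
  rewrite (sum_cells (E := E) sgb disjE (F := F) _ cE); last first.
    by move=> n i j; exact: powR_ge0.
  rewrite mulrC -nneseries_h ?indicE//; apply: lee_nneseries => [n _ _|n _].
    by rewrite lee_fin powR_ge0.
  have le := D_le _ _ _ _ s (cE n) (cE n.+1); rewrite indicE in le.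
  rewrite lee_fin /F [leRHS]mulrC.
  set x := D _ _ _ _ / _ in le *.
  have x0 : 0 <= x by rewrite divr_ge0// mulr_ge0// ltW.
  (* Since [x <= h n <= 1] and [1 < p], the [p]-th power of [x] is at most [x]; zero is split off
     because the power inequality asks for a positive base. *)
  have [->|xn0] := eqVneq x 0.
    by rewrite powR0 ?mulr_ge0 ?(ltW (h_gt0 n))// gt_eqF// (lt_trans _ p1).
  apply: le_trans le; apply: ge1r_powR; last exact: ltW.
  rewrite lt0r xn0 x0 /=; apply: le_trans (D_le _ _ _ _ s (cE n) (cE n.+1)) _.
  rewrite indicE; case: (_ \in _); first by rewrite mulr1.
  by rewrite mulr0.
split.
- move=> z; pose F n (i j : nat) := lam n `^ q.
  have [cz|ncz] := pselect (covered E z); last first.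
    by rewrite (sum_cells_uncovered (E := E) sg F ncz) lee_fin mulr_ge0// powR_ge0.
  have [c cE] := covP _ cz.
  rewrite (sum_cells (E := E) sgb disjE (F := F) _ cE); last first.
    by move=> n i j; exact: powR_ge0.
  rewrite -nneseries_h ?powR_ge0//; apply: lee_nneseries => [n _ _|n _].
    by rewrite lee_fin powR_ge0.
  rewrite lee_fin /F powRM ?(ltW (h_gt0 n))//; apply: ler_wpM2l; first exact: powR_ge0.
  by apply: ge1r_powR; [rewrite h_gt0 h_le1 | exact: ltW].
- move=> n0 y b s Cy Bb; set z := inv y ** b.
  have cz : covered E z.
    move=> n _; have [i Wi] := tP n _ _ _ Cy Bb.
    have : (\bigcup_k E0 n k) z by exists i.
    by rewrite seqDU_bigcup_eq.
  have [c cE] := covP _ cz.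
  pose F n i j := D n i j s.
  rewrite (sum_cells (E := E) sgb disjE (F := F) _ cE)//; last first.
    by move=> n i j; exact: D_ge0.
  pose u n := alpha n (t n (c n)) s.
  have uE n : F n (c n) (c n.+1) = u n.+1 - u n by exact: D_cell.
  have /andP[a0 _] := a01 (s ** z).
  under eq_eseriesr do rewrite uE.
  apply: nneseries_telescope.
  + exact: alpha0.
  + by move=> n; apply: (alphaS a0); exact: Eerr.
  + have h0 : (fun n => a (s ** z) - 3 / 2 * h n ^+ 2) @ \oo --> a (s ** z).
      rewrite -[X in _ --> X]subr0 -(mulr0 (3 / 2)).
      apply: cvgB; first exact: cvg_cst.
      apply: cvgM; first exact: cvg_cst.
      rewrite (_ : (fun n => h n ^+ 2) = fun n => (2^-1 ^+ 2) ^+ n); last first.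
        by apply/funext => n; rewrite /h -!exprM mulnC.
      by apply: cvg_expr; rewrite ger0_norm ?exprn_ge0// expr2; lra.
    apply: squeeze_cvgr h0 (cvg_cst _); apply: nearW => n.
    by apply: alpha_le => //; exact: Eerr.
Qed.

(** Integration over [t] turns cells into measures: with [m k = mu (Q k)] and [psi k y] the measure
    of [Q k] within [y^-1 B], the kernel is [\sum_k d k s * psi k y]. The factor [d k s] is divided
    by [l k] and multiplied by [m k] to the power [1/p], and [psi k y] compensates. Then the [p]-th
    powers sum to an integral over [G] of the first bound on cells, and [psi k y <= m k] reduces the
    [q]-th powers to an integral of the second bound over [y^-1 B]. *)
Lemma kernel_factorization : exists A K : nat -> G -> R,
  [/\ forall k, (forall s, 0 <= A k s) /\ measurable_fun [set: borel G] (A k : borel G -> R),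
      forall k, (forall y, 0 <= K k y) /\ measurable_fun [set: borel G] (K k : borel G -> R),
      forall s, (\sum_(k <oo) (A k s `^ p)%:E <= 2%:E * mu U)%E,
      forall y, (\sum_(k <oo) (K k y `^ q)%:E <= (2 `^ q * 2)%:E * mu B)%E &
      forall n y s, C n y -> (\sum_(k <oo) (A k s * K k y)%:E =
        \int[mu]_(t in (mul y @^-1` B : set (borel G))) (a (s ** t))%:E)%E].
Proof.
have [Q [d [l [Qfin dP l0 dl_le [l_le sum_d]]]]] := refinement_cells.
have mQ k : measurable (Q k) by case: (Qfin k).
have mUG : measurable (U : set (borel G)) by exact: borel_open.
have mB : measurable (B : set (borel G)) by exact: (borel_compact lcG).
have p0 : 0 < p by exact: lt_trans p1.
have q0 : 0 < q by exact: lt_trans q1.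
pose m k := fine (mu (Q k)).
have m0 k : 0 <= m k by exact: fine_ge0.
pose psi k y := fine (mu (mul y @^-1` B `&` Q k)).
have psi0 k y : 0 <= psi k y by exact: fine_ge0.
have mpre y : measurable (mul y @^-1` B : set (borel G)) by exact: (measurable_translate lcG).
have finI (D : set (borel G)) k : measurable D -> mu (D `&` Q k) \is a fin_num.
  move=> mD; apply: (sub_mu_fin (B := Q k)) => //; first exact: measurableI.
  by case: (Qfin k).
have psim k y : psi k y <= m k.
  apply: fine_le; [exact: finI|by case: (Qfin k)|].
  by apply: le_measure; rewrite ?inE//; exact: measurableI.
have mind (c : R) k (D : set (borel G)) :
    measurable_fun D (fun t : borel G => (c * \1_(Q k) t)%:E).
  by apply/measurable_EFinP; apply: measurable_funM.
have int_cell (c : R) k (D : set (borel G)) : measurable D -> 0 <= c ->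
    (\int[mu]_(t in D) (c * \1_(Q k) t)%:E = (c * fine (mu (D `&` Q k)))%:E)%E.
  move=> mD c0; under eq_integral do rewrite EFinM.
  rewrite ge0_integralZl_EFin//.
    by rewrite integral_indic// setIC EFinM fineK// finI.
  by apply/measurable_EFinP; exact: measurable_indic.
have int_sum (c : nat -> R) (D : set (borel G)) : measurable D -> (forall k, 0 <= c k) ->
    (\sum_(k <oo) (c k * fine (mu (D `&` Q k)))%:E =
     \int[mu]_(t in D) \sum_(k <oo) (c k * \1_(Q k) t)%:E)%E.
  move=> mD c0; rewrite integral_nneseries//; last first.
    by move=> k t _; rewrite lee_fin mulr_ge0// indicE.
  by apply: eq_eseriesr => k _; rewrite int_cell.
have msum (c : nat -> R) (D : set (borel G)) : (forall k, 0 <= c k) ->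
    measurable_fun D (fun t : borel G => \sum_(k <oo) (c k * \1_(Q k) t)%:E)%E.
  move=> c0; apply: ge0_emeasurable_sum => // k t _ _.
  by rewrite lee_fin mulr_ge0// indicE.
exists (fun k s => m k `^ p^-1 * (d k s / l k)),
  (fun k y => l k * (m k `^ (- p^-1) * psi k y)); split.
- move=> k; case: (dP k) => d0 md; split=> [s|].
    by rewrite mulr_ge0 ?powR_ge0// divr_ge0// ltW.
  by apply: measurable_funM => //; apply: measurable_funM.
- move=> k; split=> [y|].
    by rewrite !mulr_ge0 ?powR_ge0// ltW.
  apply: measurable_funM => //; apply: measurable_funM => //.
  by apply: continuous_borel; exact: (haar_translate_continuous lcG haar_mu cB (mQ k)).
- move=> s; pose c k := (d k s / l k) `^ p.
  have c0 k : 0 <= c k by exact: powR_ge0.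
  rewrite (eq_eseriesr (g := fun k => (c k * fine (mu (setT `&` Q k)))%:E)); last first.
    move=> k _; case: (dP k) => d0 _.
    rewrite powRM ?powR_ge0 ?divr_ge0 ?(ltW (l0 k))// -powRrM mulVf ?gt_eqF// powRr1//.
    by rewrite mulrC setTI.
  rewrite int_sum//.
  have mUs : measurable (mul s @^-1` U : set (borel G)) by exact: (measurable_translate lcG).
  rewrite -(haar_preimage lcG haar_mu s mUG) -[X in (_ * mu X)%E]setIT -integral_indic//.
  rewrite -ge0_integralZl_EFin//; last first.
    by apply/measurable_EFinP; exact: measurable_indic.
  apply: ge0_le_integral => //.
  + by move=> t _; apply: nneseries_ge0 => k _ _; rewrite lee_fin mulr_ge0// indicE.
  + exact: msum.
  + by apply/measurable_EFinP; apply: measurable_funM.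
  + by move=> t _; exact: dl_le.
- move=> y.
  apply: (@le_trans _ _ (\sum_(k <oo) (l k `^ q * psi k y)%:E)%E).
    apply: lee_nneseries => [k _ _|k _]; first by rewrite lee_fin powR_ge0.
    rewrite lee_fin powRM ?mulr_ge0 ?powR_ge0 ?(ltW (l0 k))//.
    apply: ler_wpM2l; first exact: powR_ge0.
    have [psi_eq0|psin0] := eqVneq (psi k y) 0.
      by rewrite psi_eq0 mulr0 powR0// gt_eqF.
    have psi_gt0 : 0 < psi k y by rewrite lt0r psin0 psi0.
    have m_gt0 : 0 < m k by exact: lt_le_trans psi_gt0 _.
    (* Conjugacy gives [q / p = q - 1], so what remains to be bounded by 1 is the power [q - 1] of
       the ratio of [psi k y] to [m k]. *)
    have qp : p^-1 * q = q - 1.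
      have -> : p^-1 = 1 - q^-1 by rewrite -pq addrK.
      by rewrite mulrBl mul1r mulVf// gt_eqF.
    rewrite powRM ?powR_ge0// -powRrM mulNr qp powRN -(mulr_powRB1 (psi0 k y) q0).
    rewrite mulrCA -[leRHS]mulr1; apply: ler_wpM2l => //.
    rewrite mulrC ler_pdivrMr ?powR_gt0// mul1r.
    by apply: ge0_ler_powR; rewrite ?nnegrE// ?subr_ge0 ltW.
  rewrite int_sum//; last by move=> k; exact: powR_ge0.
  rewrite -(haar_preimage lcG haar_mu y mB) -integral_cst//.
  apply: ge0_le_integral => //.
  + by move=> t _; apply: nneseries_ge0 => k _ _; rewrite lee_fin mulr_ge0// ?powR_ge0// indicE.
  + by apply: msum => k; exact: powR_ge0.
- move=> n y s Cy.
  rewrite (eq_eseriesr (g := fun k => (d k s * psi k y)%:E)); last first.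
    move=> k _; congr (_%:E).
    (* When [m k = 0] its two powers do not cancel, but then [psi k y] vanishes too. *)
    have [psi_eq0|psin0] := eqVneq (psi k y) 0; first by rewrite psi_eq0 !mulr0.
    have m_gt0 : 0 < m k by apply: lt_le_trans (psim k y); rewrite lt0r psin0 psi0.
    have mp0 : m k `^ p^-1 != 0 by rewrite gt_eqF// powR_gt0.
    rewrite powRN; field.
    by rewrite mp0 gt_eqF.
  rewrite int_sum//; last by move=> k; case: (dP k).
  apply: eq_integral => t /set_mem Bt; rewrite -(gmulK lcG y t).
  exact: (sum_d n).
Qed.

End kernel.

(** * Multipliers of the Herz algebra *)

Section complex_modulus.
Context {R : realType}.
Implicit Types (x y z : R[i]).

Lemma cabsE z : cabs z = Normc.normc z.
Proof. by case: z. Qed.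

Lemma cabs_ge0 z : 0 <= cabs z.
Proof. exact: sqrtr_ge0. Qed.

Lemma cabsM x y : cabs (x * y) = cabs x * cabs y.
Proof. by rewrite !cabsE Normc.normcM. Qed.

Lemma cabs_real (r : R) : cabs r%:C%C = `|r|.
Proof. by rewrite /cabs /= expr0n addr0 sqrtr_sqr. Qed.

Lemma cabs0 : cabs (0 : R[i]) = 0.
Proof. by rewrite cabsE Normc.normc0. Qed.

Lemma cabs_eq0 z : cabs z = 0 -> z = 0.
Proof. by rewrite cabsE; exact: Normc.eq0_normc. Qed.

Lemma Re_le_cabs z : `|complex.Re z| <= cabs z.
Proof. by rewrite -sqrtr_sqr ler_wsqrtr// lerDl sqr_ge0. Qed.

Lemma Im_le_cabs z : `|complex.Im z| <= cabs z.
Proof. by rewrite -sqrtr_sqr ler_wsqrtr// lerDr sqr_ge0. Qed.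

Lemma cabs_le z : cabs z <= `|complex.Re z| + `|complex.Im z|.
Proof.
rewrite -[leRHS]ger0_norm ?addr_ge0// -sqrtr_sqr ler_wsqrtr//.
rewrite sqrrD !real_normK ?num_real// addrAC lerDl.
by rewrite mulrn_wge0// mulr_ge0.
Qed.

Lemma ReM x y : complex.Re (x * y) =
  complex.Re x * complex.Re y - complex.Im x * complex.Im y.
Proof. by case: x; case: y. Qed.

Lemma ImM x y : complex.Im (x * y) =
  complex.Re x * complex.Im y + complex.Im x * complex.Re y.
Proof. by case: x; case: y. Qed.

Lemma Re_realM (r : R) z : complex.Re (r%:C%C * z) = r * complex.Re z.
Proof. by rewrite ReM /= mul0r subr0. Qed.

Lemma Im_realM (r : R) z : complex.Im (r%:C%C * z) = r * complex.Im z.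
Proof. by rewrite ImM /= mul0r addr0. Qed.

End complex_modulus.

(** * L^p norms of complex functions and bounds on convolutions *)

Section Lp.
Context {R : realType} {G : ptopologicalType}.
Context {mul : G -> G -> G} {inv : G -> G} {e : G}.
Context {mu : {measure set (borel G) -> \bar R}}.
Hypothesis lcG : locally_compact_group mul inv e.
Hypothesis haar_mu : left_haar_measure mul mu.
Local Notation "x ** y" := (mul x y) (at level 40, left associativity).
Implicit Types (f g u v : G -> R[i]).

Lemma cmeasurableM f g : cmeasurable f -> cmeasurable g ->
  cmeasurable (fun x => f x * g x).
Proof.
move=> [f1 f2] [g1 g2]; split.
  under eq_fun do rewrite ReM.
  by apply: measurable_funB; exact: measurable_funM.
under eq_fun do rewrite ImM.
by apply: measurable_funD; exact: measurable_funM.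
Qed.

Lemma cmeasurable_real (c : G -> R) :
  measurable_fun [set: borel G] (c : borel G -> R) ->
  cmeasurable (fun x => (c x)%:C%C).
Proof. by move=> mc; split => //=; exact: measurable_cst. Qed.

Lemma cmeasurable_translate f z : cmeasurable f -> cmeasurable (fun y => f (z ** y)).
Proof.
have mz : measurable_fun [set: borel G] (mul z : borel G -> borel G).
  exact: (continuous_borel_self (@lmul_continuous _ _ _ _ lcG z)).
by case=> f1 f2; split; [exact: (measurableT_comp f1 mz)|exact: (measurableT_comp f2 mz)].
Qed.

Lemma measurable_cabs f : cmeasurable f ->
  measurable_fun [set: borel G] (fun x : borel G => cabs (f x)).
Proof.
have ms : measurable_fun [set: R] (@Num.sqrt R : R -> R).
  by apply: continuous_measurable_fun; exact: sqrt_continuous.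
move=> [f1 f2]; apply: (measurableT_comp ms).
by apply: measurable_funD; exact: measurable_funX.
Qed.

Lemma Lpnorm_ge0 (r : R) f : (0 <= Lpnorm mu r f)%E.
Proof. exact: Lnorm_ge0. Qed.

Lemma inLp_fin (r : R) f : inLp mu r f -> Lpnorm mu r f \is a fin_num.
Proof. by case=> _ foo; rewrite ge0_fin_numE// Lpnorm_ge0. Qed.

Lemma Lpnorm_powR (r : R) f : 0 < r ->
  (Lpnorm mu r f `^ r = \int[mu]_x (cabs (f x) `^ r)%:E)%E.
Proof.
move=> r0; rewrite /Lpnorm poweR_Lnorm ?gt_eqF//.
by apply: eq_integral => x _ /=; rewrite ger0_norm// cabs_ge0.
Qed.

Lemma inLp_powR (r : R) f : 0 < r -> inLp mu r f ->
  (\int[mu]_x (cabs (f x) `^ r)%:E = (fine (Lpnorm mu r f) `^ r)%:E)%E.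
Proof. by move=> r0 /inLp_fin fin; rewrite -Lpnorm_powR// -[in LHS](fineK fin). Qed.

Lemma inLp_le (r : R) f g : 0 < r -> cmeasurable f -> inLp mu r g ->
  (forall x, cabs (f x) <= cabs (g x)) -> inLp mu r f.
Proof.
move=> r0 mf lg fg; split=> //; case: (lg) => mg _.
have : (\int[mu]_x (cabs (f x) `^ r)%:E < +oo)%E.
  apply: (@le_lt_trans _ _ (\int[mu]_x (cabs (g x) `^ r)%:E)%E).
    apply: ge0_le_integral => //.
    - by move=> x _; rewrite lee_fin powR_ge0.
    - apply/measurable_EFinP; apply: (measurableT_comp (measurable_powR r)).
      exact: measurable_cabs.
    - apply/measurable_EFinP; apply: (measurableT_comp (measurable_powR r)).
      exact: measurable_cabs.
    - move=> x _; rewrite lee_fin; apply: ge0_ler_powR => //; rewrite ?nnegrE ?cabs_ge0//.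
      exact: ltW.
  by rewrite inLp_powR// ltry.
rewrite -Lpnorm_powR//; apply: contraTT.
rewrite -!leNgt !leye_eq => /eqP ->.
by rewrite poweRyr ?eqxx// gt_eqF.
Qed.

Lemma Lpnorm_translate (r : R) f z : 0 < r -> cmeasurable f ->
  Lpnorm mu r (fun y => f (z ** y)) = Lpnorm mu r f.
Proof.
move=> r0 mf; rewrite /Lpnorm Lnorm.unlock.
have mg : measurable_fun [set: borel G] (fun x : borel G => (`|(cabs (f x))%:E| `^ r)%E).
  apply: (measurableT_comp (measurable_poweR r)).
  by apply: measurableT_comp => //; apply/measurable_EFinP; exact: measurable_cabs.
by have /= -> := haar_integral lcG haar_mu z mg.
Qed.

Context {p q : R}.
Hypothesis p0 : 0 < p.
Hypothesis q0 : 0 < q.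
Hypothesis pq : p^-1 + q^-1 = 1.

(** Hoelder's inequality for [g] and a left translate of [f], which has the norm of [f]. The real
    function [rho] stands for the real or the imaginary part of the convolution integrand. *)
Lemma integrable_of_hoelder f g z (rho : G -> R) : inLp mu p f -> inLp mu q g ->
  measurable_fun [set: borel G] (rho : borel G -> R) ->
  (forall y, `|rho y| <= cabs (g y) * cabs (f (inv z ** y))) ->
  mu.-integrable [set: borel G] (EFin \o rho : borel G -> \bar R) /\
  `|Rintegral mu [set: borel G] rho| <=
    fine (Lpnorm mu p f) * fine (Lpnorm mu q g).
Proof.
move=> lf lg mrho le_rho; have [[mf _] [mg _]] := (lf, lg).
have mfz := cmeasurable_translate (inv z) mf.
have H : (\int[mu]_y `|(rho y)%:E| <=
    (fine (Lpnorm mu p f) * fine (Lpnorm mu q g))%:E)%E.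
  rewrite EFinM !fineK ?inLp_fin// -(Lpnorm_translate (inv z) p0 mf) muleC.
  apply: le_trans (hoelder mu (measurable_cabs mg) (measurable_cabs mfz) q0 p0 _); last first.
    by rewrite addrC.
  rewrite Lnorm1; apply: ge0_le_integral => //.
  - by apply/measurable_EFinP/measurableT_comp.
  - apply/measurable_EFinP/measurableT_comp => //.
    by apply: measurable_funM; exact: measurable_cabs.
  - move=> y _ /=; rewrite lee_fin; apply: le_trans (le_rho y) _.
    exact: ler_norm.
have int : mu.-integrable [set: borel G] (EFin \o rho : borel G -> \bar R).
  apply/integrableP; split; first exact/measurable_EFinP.
  by apply: le_lt_trans H _; rewrite ltry.
split=> //; rewrite -lee_fin; apply: le_trans H.
rewrite EFin_normr_Rintegral//.
by apply: le_abse_integral => //; exact/measurable_EFinP.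
Qed.

Lemma convE g f z : Defs.conv mul inv mu g (fvee inv f) z =
  cintegral mu (fun y => g y * f (inv z ** y)).
Proof.
rewrite /Defs.conv /fvee; congr cintegral; apply/funext => y.
by rewrite (ginvM lcG) (ginvK lcG).
Qed.

Lemma conv_le f g z : inLp mu p f -> inLp mu q g ->
  `|complex.Re (Defs.conv mul inv mu g (fvee inv f) z)| <=
    fine (Lpnorm mu p f) * fine (Lpnorm mu q g) /\
  `|complex.Im (Defs.conv mul inv mu g (fvee inv f) z)| <=
    fine (Lpnorm mu p f) * fine (Lpnorm mu q g).
Proof.
move=> lf lg; rewrite convE.
have [m1 m2] : cmeasurable (fun y => g y * f (inv z ** y)).
  by apply: cmeasurableM; [case: lg|apply: cmeasurable_translate; case: lf].
split; apply: (proj2 (@integrable_of_hoelder f g z _ lf lg _ _)) => // y.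
  by rewrite -cabsM; exact: Re_le_cabs.
by rewrite -cabsM; exact: Im_le_cabs.
Qed.

End Lp.

(** * Supports of L^r functions *)

Section sigma_compact_support.
Context {R : realType} {G : ptopologicalType}.
Context {mul : G -> G -> G} {inv : G -> G} {e : G}.
Context {mu : {measure set (borel G) -> \bar R}}.
Hypothesis lcG : locally_compact_group mul inv e.
Hypothesis haar_mu : left_haar_measure mul mu.

Lemma inner_compact (U : set G) (eps : R) : open U -> mu U \is a fin_num ->
  0 < eps -> exists K : set G, [/\ compact K, K `<=` U & (mu (U `\` K) <= eps%:E)%E].
Proof.
move=> oU Ufin eps0; case: haar_mu => _ _ _ _ /(_ U oU) UE.
have [|_ [K [cK KU] <-]] := @ub_ereal_sup_adherent _
  [set mu K | K in [set K : set G | compact K /\ K `<=` U]] _ eps0; rewrite -UE//.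
have mU := borel_open oU; have mK := borel_compact lcG cK.
move=> UK; exists K; split=> //; rewrite measureD//; last by rewrite ltey_eq Ufin.
have Kfin := compact_mu_fin haar_mu cK.
rewrite (_ : U `&` K = K); last by apply/setIidPr.
rewrite leeBlDr//; move: UK; rewrite lteBlDr// => /ltW.
by rewrite addeC.
Qed.

(** The level sets [|g| >= 1/(m+1)] have finite measure by Markov's inequality. Inner regularity is
    given for open sets, so each level set is first enclosed in an open set of finite measure, which
    compact sets exhaust up to a null set. *)
Lemma Lp_sigma_compact_support (r : R) (g : G -> R[i]) : 0 < r -> inLp mu r g ->
  exists K : nat -> set G, (forall n, compact (K n)) /\
    {ae mu, forall x : borel G, g x != 0 -> exists n, K n x}.
Proof.
move=> r0 lg; have [mg _] := lg; have mcg := measurable_cabs mg.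
pose A m : set (borel G) := [set x | m.+1%:R^-1 <= cabs (g x)].
have mA m : measurable (A m).
  rewrite (_ : A m = [set: borel G] `&`
    (fun x : borel G => cabs (g x)) @^-1` `[m.+1%:R^-1, +oo[%classic).
    by apply: mcg => //; exact: measurable_itv.
  by apply/seteqP; split => x; rewrite /A /= in_itv/= andbT => // -[].
have Aoo m : (mu (A m) < +oo)%E.
  have c0 : 0 < (m.+1%:R^-1 : R) `^ r by rewrite powR_gt0// invr_gt0.
  have : (((m.+1%:R^-1 : R) `^ r)%:E * mu (A m) < +oo)%E.
    rewrite -[X in (_ * mu X)%E]setIT -integral_indic//.
    rewrite -ge0_integralZl_EFin ?(ltW c0)//; last first.
      by apply/measurable_EFinP; exact: measurable_indic.
    apply: (@le_lt_trans _ _ (\int[mu]_x (cabs (g x) `^ r)%:E)%E); last first.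
      by rewrite inLp_powR// ltry.
    apply: ge0_le_integral => //.
    - by apply: measurable_funeM; apply/measurable_EFinP; exact: measurable_indic.
    - by apply/measurable_EFinP; exact: (measurableT_comp (measurable_powR r)).
    - move=> x _; rewrite -EFinM lee_fin indicE.
      have [/set_mem Ax|_] := boolP (x \in A m); last by rewrite mulr0 powR_ge0.
      rewrite mulr1; apply: ge0_ler_powR; rewrite ?nnegrE ?cabs_ge0 ?invr_ge0//.
      exact: ltW.
  apply: contraTT; rewrite -!leNgt !leye_eq => /eqP ->.
  by rewrite gt0_muley ?lte_fin.
have /choice[U UP] m : exists U : set G, [/\ open U, A m `<=` U & mu U \is a fin_num].
  have [U [oU AU UA]] := outer_open haar_mu (mA m) (Aoo m) ltr01.
  exists U; split=> //; rewrite ge0_fin_numE//; apply: lt_le_trans UA _.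
  by rewrite leey.
have /choice[K KP] (mn : nat * nat) : exists K : set G,
    [/\ compact K, K `<=` U mn.1 & (mu (U mn.1 `\` K) <= (mn.2.+1%:R^-1 : R)%:E)%E].
  by have [oU _ Ufin] := UP mn.1; apply: inner_compact => //; rewrite invr_gt0.
have [sg [_ _ sgb]] := exists_nat_pair_bij.
exists (K \o sg); split=> [n|]; first by case: (KP (sg n)).
have mK mn : measurable (K mn : set (borel G)) by case: (KP mn) => /(borel_compact lcG).
have mU m : measurable (U m : set (borel G)) by case: (UP m) => /borel_open.
pose N m : set (borel G) := U m `\` \bigcup_n K (m, n).
have mN m : measurable (N m) by apply: measurableD => //; exact: bigcupT_measurable.
have N0 m : mu (N m) = 0%E.
  apply/eqP; rewrite eq_le measure_ge0 andbT.
  apply/lee_addgt0Pr => eps eps0; rewrite add0e.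
  have [n _ ne] := near_infty_natSinv_lt (PosNum eps0).
  case: (KP (m, n)) => _ _ Kn.
  apply: (@le_trans _ _ (mu (U m `\` K (m, n)))).
    apply: le_measure; rewrite ?inE//; first exact: measurableD.
    by move=> x [Ux nK]; split=> // Kx; apply: nK; exists n.
  by apply: (le_trans Kn); rewrite lee_fin ltW//; apply: (ne n) => /=.
have : mu.-negligible (\bigcup_m N m).
  by apply: negligible_bigcup => m; exists (N m); split.
apply: negligibleS => x /= /not_implyP[gx0 nK].
have cg0 : 0 < cabs (g x).
  rewrite lt0r cabs_ge0 andbT; apply: contra gx0 => /eqP /cabs_eq0 ->.
  exact: eqxx.
have [m _ me] := near_infty_natSinv_lt (PosNum cg0).
exists m => //; split.
  by case: (UP m) => _ AU _; apply: AU; apply: ltW; apply: (me m) => /=.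
move=> [n _ Kx]; apply: nK; have [k _ sk] := sgb (m, n) I.
by exists k; rewrite /= sk.
Qed.

End sigma_compact_support.

(** * Multiplication of [A_p] by a factorizable function *)

Section multipliers.
Context {R : realType} {G : ptopologicalType}.
Context {mul : G -> G -> G} {inv : G -> G} {e : G}.
Context {mu : {measure set (borel G) -> \bar R}}.
Hypothesis lcG : locally_compact_group mul inv e.
Hypothesis haar_mu : left_haar_measure mul mu.
Local Notation "x ** y" := (mul x y) (at level 40, left associativity).

(** Dominated convergence: partial sums of [w] lie in [[0, 1]], so [|rho|] dominates. The sum is
    prescribed only where [rho] is nonzero, because a factorization is valid only over the
    sigma-compact set carrying the integrand. *)
Lemma series_Rintegral (rho : G -> R) (w : nat -> G -> R) (r : R) :
  mu.-integrable [set: borel G] (EFin \o rho : borel G -> \bar R) ->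
  (forall k, measurable_fun [set: borel G] (w k : borel G -> R)) ->
  (forall k y, 0 <= w k y) ->
  (forall y, (\sum_(k <oo) (w k y)%:E <= 1)%E) ->
  {ae mu, forall y : borel G, rho y != 0 -> (\sum_(k <oo) (w k y)%:E = r%:E)%E} ->
  series (fun k => Rintegral mu [set: borel G] (fun y => rho y * w k y)) @ \oo -->
    r * Rintegral mu [set: borel G] rho.
Proof.
move=> irho mw w0 w1 wr.
have mrho : measurable_fun [set: borel G] (rho : borel G -> R).
  by case/integrableP : irho => /measurable_EFinP.
pose S n y := \sum_(0 <= k < n) w k y.
have S0 n y : 0 <= S n y by exact: sumr_ge0.
have S1 n y : S n y <= 1.
  rewrite -lee_fin; apply: le_trans (w1 y); rewrite -sumEFin.
  by apply: nneseries_lim_ge => k _ _; rewrite lee_fin.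
have mS n : measurable_fun [set: borel G] (S n : borel G -> R).
  exact: measurable_sum.
have irhoM (c : G -> R) : measurable_fun [set: borel G] (c : borel G -> R) ->
    (forall y, 0 <= c y <= 1) ->
    mu.-integrable [set: borel G] (EFin \o (fun y => rho y * c y) : borel G -> \bar R).
  move=> mc c01; apply: le_integrable irho => //.
    by apply/measurable_EFinP; exact: measurable_funM.
  move=> y _ /=; rewrite lee_fin normrM; have /andP[c0 c1] := c01 y.
  by rewrite (ger0_norm c0) ler_piMr.
have w01 k y : 0 <= w k y <= 1.
  rewrite w0 /= -lee_fin; apply: le_trans (w1 y).
  rewrite (nneseriesD1 (n := k))//; last by move=> j _; rewrite lee_fin.
  by rewrite leeDl// nneseries_ge0// => j _ _; rewrite lee_fin.
have -> : series (fun k => Rintegral mu [set: borel G] (fun y => rho y * w k y)) =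
    fun n => Rintegral mu [set: borel G] (fun y => rho y * S n y).
  apply/funext; elim=> [|n IH].
    rewrite /series /= big_nil /S.
    under eq_Rintegral do rewrite big_nil mulr0.
    by rewrite /Rintegral integral0.
  rewrite seriesSr IH /S.
  under [in RHS]eq_Rintegral do rewrite big_nat_recr//= mulrDr.
  rewrite RintegralD//.
  - by apply: (irhoM _ (mS n)) => y; rewrite S0 S1.
  - exact: (irhoM _ (mw n) (w01 n)).
rewrite -RintegralZl//; apply: fine_cvg; rewrite fineK; last first.
  apply: integrable_fin_num => //; exact: (integrableZl measurableT r irho).
have mf n : measurable_fun [set: borel G] (fun y : borel G => (rho y * S n y)%:E).
  by apply/measurable_EFinP; exact: measurable_funM.
have mrrho : measurable_fun [set: borel G] (fun y : borel G => (r * rho y)%:E).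
  by apply/measurable_EFinP; exact: measurable_funM.
have ae_cvg : {ae mu, forall y : borel G, setT y ->
    (fun n => (rho y * S n y)%:E) @ \oo --> (r * rho y)%:E}.
  apply: filterS wr => y yr _; apply/fine_cvgP; split; first exact: nearW.
  have [->|/yr H] := eqVneq (rho y) 0.
    rewrite mulr0; under eq_fun do rewrite /= mul0r; exact: cvg_cst.
  rewrite mulrC; apply: cvgM; first exact: cvg_cst.
  by apply/cvg_nnseriesP.
have ae_dom : {ae mu, forall (y : borel G) n, setT y ->
    (`|(rho y * S n y)%:E| <= `|(rho y)%:E|)%E}.
  apply: aeW => y n _; rewrite lee_fin normrM (ger0_norm (S0 n y)).
  by rewrite ler_piMr.
by have [] := dominated_convergence measurableT mf mrrho ae_cvg (integrable_abse irho) ae_dom.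
Qed.

(** Sum and integral of nonnegative functions commute, so sending [f] to the sequence of the
    [A k * f] is a contraction from L^r to the l^r-valued L^r functions. *)
Lemma sum_Lpnorm_le (r : R) (A : nat -> G -> R) (f : G -> R[i]) : 0 < r ->
  (forall k, (forall s, 0 <= A k s) /\ measurable_fun [set: borel G] (A k : borel G -> R)) ->
  (forall s, (\sum_(k <oo) (A k s `^ r)%:E <= 1)%E) -> inLp mu r f ->
  (forall k, inLp mu r (fun x => (A k x)%:C%C * f x)) /\
  (\sum_(k <oo) (fine (Lpnorm mu r (fun x => (A k x)%:C%C * f x)) `^ r)%:E <=
    (fine (Lpnorm mu r f) `^ r)%:E)%E.
Proof.
move=> r0 HA A1 lf; have [mf _] := lf.
have mA k : cmeasurable (fun x => (A k x)%:C%C * f x).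
  by apply: cmeasurableM => //; apply: cmeasurable_real; case: (HA k).
have cA k x : cabs ((A k x)%:C%C * f x) = A k x * cabs (f x).
  by rewrite cabsM cabs_real ger0_norm//; case: (HA k).
have A_le1 k x : A k x <= 1.
  have [A0 _] := HA k.
  have Ar1 : A k x `^ r <= 1.
    rewrite -lee_fin; apply: le_trans (A1 x).
    rewrite (nneseriesD1 (n := k))//; last by move=> j _; rewrite lee_fin powR_ge0.
    by rewrite leeDl// nneseries_ge0// => j _ _; rewrite lee_fin powR_ge0.
  have -> : A k x = (A k x `^ r) `^ r^-1.
    by rewrite -powRrM mulfV ?gt_eqF// powRr1.
  apply: (@le_trans _ _ (1 `^ r^-1)); last by rewrite powR1.
  by apply: ge0_ler_powR; rewrite ?nnegrE ?powR_ge0// invr_ge0 ltW.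
have lA k : inLp mu r (fun x => (A k x)%:C%C * f x).
  apply: (inLp_le r0 (mA k) lf) => x; rewrite cA.
  by rewrite ler_piMl// cabs_ge0.
split=> //.
have mpow (h : G -> R) : measurable_fun [set: borel G] (h : borel G -> R) ->
    measurable_fun [set: borel G] (fun x : borel G => (h x `^ r)%:E).
  by move=> mh; apply/measurable_EFinP; exact: (measurableT_comp (measurable_powR r)).
rewrite -inLp_powR//.
rewrite (eq_eseriesr (g := fun k => \int[mu]_x (cabs ((A k x)%:C%C * f x) `^ r)%:E)%E);
  last by move=> k _; rewrite inLp_powR.
have mcA k : measurable_fun [set: borel G]
    (fun x : borel G => (cabs ((A k x)%:C%C * f x) `^ r)%:E).
  exact: (mpow _ (measurable_cabs (mA k))).
have cA0 k (x : G) : (0 <= (cabs ((A k x)%:C%C * f x) `^ r)%:E)%E.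
  by rewrite lee_fin powR_ge0.
rewrite -integral_nneseries//; apply: ge0_le_integral => //.
- by move=> x _; exact: nneseries_ge0.
- exact: ge0_emeasurable_sum.
- exact: (mpow _ (measurable_cabs mf)).
- move=> x _.
  rewrite (eq_eseriesr (g := fun k => (cabs (f x) `^ r)%:E * (A k x `^ r)%:E)%E); last first.
    move=> k _; have [A0 _] := HA k.
    by rewrite cA powRM ?cabs_ge0// mulrC EFinM.
  rewrite nneseriesZl; last by move=> k _; rewrite lee_fin powR_ge0.
  rewrite -[leRHS]mule1; apply: lee_pmul => //.
    by rewrite lee_fin powR_ge0.
  by apply: nneseries_ge0 => k _ _; rewrite lee_fin powR_ge0.
Qed.

Section fixed_exponent.
Context {p : R}.
Hypothesis p1 : 1 < p.
Local Notation q := (conj_exp p).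

Lemma conj_exp_gt1 : 1 < q.
Proof. by rewrite /conj_exp ltr_pdivlMr ?subr_gt0// mul1r ltrBlDr ltrDl. Qed.

Lemma conj_exp_inv : p^-1 + q^-1 = 1.
Proof.
rewrite /conj_exp; field; apply/andP; split; rewrite ?gt_eqF ?subr_gt0//.
exact: lt_trans p1.
Qed.

Let p0 : 0 < p. Proof. exact: lt_trans p1. Qed.
Let q0 : 0 < q. Proof. exact: lt_trans conj_exp_gt1. Qed.

(* Over every sigma-compact set of [y]'s, [r] is an l^p-l^q coefficient of
   norm at most 1: a discrete form of Fell absorption. *)
Definition factorizable (r : G -> R) := forall C : nat -> set G,
  (forall n, compact (C n)) -> exists A K : nat -> G -> R,
  [/\ forall k, (forall s, 0 <= A k s) /\ measurable_fun [set: borel G] (A k : borel G -> R),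
      forall k, (forall y, 0 <= K k y) /\ measurable_fun [set: borel G] (K k : borel G -> R),
      forall s, (\sum_(k <oo) (A k s `^ p)%:E <= 1)%E,
      forall y, (\sum_(k <oo) (K k y `^ q)%:E <= 1)%E &
      forall n y z, C n y ->
        (\sum_(k <oo) (A k (inv z ** y) * K k y)%:E = (r z)%:E)%E].

(** Under the integral over [y], [r z] is expanded as the sum of [A k (z^-1 y) * K k y]. The first
    factor shares the argument of [fs i] and the second that of [gs i], so each summand is again a
    convolution; discrete Hoelder for each [i] keeps the total cost from growing. *)
Lemma Ap_rep_factorizable (r : G -> R) (v : G -> R[i]) fs gs : factorizable r ->
  Ap_rep mul inv mu p v fs gs ->
  exists fs' gs', Ap_rep mul inv mu p (fmul (fun x => (r x)%:C%C) v) fs' gs' /\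
    limn (series (fun i => fine (Lpnorm mu p (fs' i)) * fine (Lpnorm mu q (gs' i)))) <=
    limn (series (fun i => fine (Lpnorm mu p (fs i)) * fine (Lpnorm mu q (gs i)))).
Proof.
move=> fac [lf lg cost rep].
have /choice[C0 C0P] i : exists K : nat -> set G, (forall n, compact (K n)) /\
    {ae mu, forall x : borel G, gs i x != 0 -> exists n, K n x}.
  exact: (Lp_sigma_compact_support lcG haar_mu q0).
have [sg sgb] := exists_nat_pair_bij; have [_ _ sgs] := sgb.
(* The sets carrying all the [gs i] are merged into one sequence, so a single factorization serves
   every [i]. *)
have [n|A [K [HA HK A1 K1 AK]]] := fac (fun N => C0 (sg N).1 (sg N).2).
  by case: (C0P (sg n).1).
have carr i : {ae mu, forall y : borel G, gs i y != 0 -> forall z,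
    (\sum_(k <oo) (A k (inv z ** y) * K k y)%:E = (r z)%:E)%E}.
  apply: filterS (proj2 (C0P i)) => y gy /gy[n Cy] z.
  have [N _ sN] := sgs (i, n) I.
  by apply: (AK N); rewrite sN.
have lfA i := sum_Lpnorm_le p0 HA A1 (lf i).
have lgK i := sum_Lpnorm_le q0 HK K1 (lg i).
pose F i k x := (A k x)%:C%C * fs i x.
pose H i k x := (K k x)%:C%C * gs i x.
pose NF i k := fine (Lpnorm mu p (F i k)).
pose NH i k := fine (Lpnorm mu q (H i k)).
have NF0 i k : 0 <= NF i k by rewrite fine_ge0 ?Lpnorm_ge0.
have NH0 i k : 0 <= NH i k by rewrite fine_ge0 ?Lpnorm_ge0.
pose nf i := fine (Lpnorm mu p (fs i)).
pose ng i := fine (Lpnorm mu q (gs i)).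
have nf0 i : 0 <= nf i by rewrite fine_ge0 ?Lpnorm_ge0.
have ng0 i : 0 <= ng i by rewrite fine_ge0 ?Lpnorm_ge0.
have hoe i : (\sum_(k <oo) (NF i k * NH i k)%:E <= (nf i * ng i)%:E)%E.
  apply: (hoelder_nneseries p0 q0 conj_exp_inv) => //.
    by case: (lfA i).
  by case: (lgK i).
pose c := limn (series (fun i => nf i * ng i)).
have cE : (\sum_(i <oo) (nf i * ng i)%:E = c%:E)%E.
  by apply/cvg_nnseriesP => // i; rewrite mulr_ge0.
have tot : (\sum_(i <oo) \sum_(k <oo) (NF i k * NH i k)%:E <= c%:E)%E.
  rewrite -cE; apply: lee_nneseries => [i _ _|i _]; last exact: hoe.
  by apply: nneseries_ge0 => k _ _; rewrite lee_fin mulr_ge0.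
have costN : (\sum_(N <oo) (NF (sg N).1 (sg N).2 * NH (sg N).1 (sg N).2)%:E <= c%:E)%E.
  rewrite (nneseries_pair (f := fun i k => (NF i k * NH i k)%:E) sgb)// => i k.
  by rewrite lee_fin mulr_ge0.
have ccost : cvgn (series (fun N => NF (sg N).1 (sg N).2 * NH (sg N).1 (sg N).2)).
  apply: nnseries_is_cvg => [N|]; first by rewrite mulr_ge0.
  by apply: le_lt_trans costN _; rewrite ltry.
exists (fun N => F (sg N).1 (sg N).2), (fun N => H (sg N).1 (sg N).2); split; last first.
  rewrite -lee_fin -/c -EFin_lim//.
  apply: le_trans costN.
  rewrite le_eqVlt; apply/orP; left; apply/eqP.
  by congr (limn _); apply/funext => n /=; rewrite /series /= sumEFin.
have convs i z :
    series (fun k => complex.Re (Defs.conv mul inv mu (H i k) (fvee inv (F i k)) z)) @ \oo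
      --> r z * complex.Re (Defs.conv mul inv mu (gs i) (fvee inv (fs i)) z) /\
    series (fun k => complex.Im (Defs.conv mul inv mu (H i k) (fvee inv (F i k)) z)) @ \oo
      --> r z * complex.Im (Defs.conv mul inv mu (gs i) (fvee inv (fs i)) z).
  pose w k y := A k (inv z ** y) * K k y.
  have mw k : measurable_fun [set: borel G] (w k : borel G -> R).
    apply: measurable_funM; last by case: (HK k).
    apply: (measurableT_comp (proj2 (HA k))).
    exact: (continuous_borel_self (@lmul_continuous _ _ _ _ lcG (inv z))).
  have w0 k y : 0 <= w k y by apply: mulr_ge0; [case: (HA k)|case: (HK k)].
  have w1 y : (\sum_(k <oo) (w k y)%:E <= 1)%E.
    have -> : 1%E = (1 * 1 : R)%:E by rewrite mulr1.
    apply: (hoelder_nneseries p0 q0 conj_exp_inv) => //.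
    - by move=> k; case: (HA k).
    - by move=> k; case: (HK k).
    - by rewrite powR1; exact: A1.
    - by rewrite powR1; exact: K1.
  (* [rho] will be the real part, then the imaginary part; only real homogeneity and domination by
     the modulus enter. *)
  have part (rho : R[i] -> R) (rhoP : forall (a : R) x, rho (a%:C%C * x) = a * rho x)
      (rho_le : forall x, `|rho x| <= cabs x) :
      measurable_fun [set: borel G] (fun y : borel G => rho (gs i y * fs i (inv z ** y))) ->
      series (fun k =>
        Rintegral mu [set: borel G] (fun y => rho (H i k y * F i k (inv z ** y)))) @ \oo
        --> r z * Rintegral mu [set: borel G] (fun y => rho (gs i y * fs i (inv z ** y))).
    move=> mrho.
    have rho_leM y : `|rho (gs i y * fs i (inv z ** y))| <=
        cabs (gs i y) * cabs (fs i (inv z ** y)) by rewrite -cabsM.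
    have [irho _] := integrable_of_hoelder lcG haar_mu p0 q0 conj_exp_inv (lf i) (lg i) mrho
      rho_leM.
    have ae : {ae mu, forall y : borel G, rho (gs i y * fs i (inv z ** y)) != 0 ->
        (\sum_(k <oo) (w k y)%:E = (r z)%:E)%E}.
      apply: filterS (carr i) => y cy rho0; apply: cy.
      apply: contra rho0 => /eqP ->; rewrite mul0r -normr_eq0 eq_le normr_ge0 andbT.
      by rewrite -[leRHS](@cabs0 R).
    have := series_Rintegral irho mw w0 w1 ae.
    rewrite (_ : (fun k => _) = (fun k => Rintegral mu [set: borel G]
      (fun y => rho (H i k y * F i k (inv z ** y)))))//.
    apply/funext => k; apply: eq_Rintegral => y _.
    by rewrite /H /F mulrACA -rmorphM rhoP /w /= mulrC [K k y * _]mulrC.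
  have [m1 m2] : cmeasurable (fun y => gs i y * fs i (inv z ** y)).
    apply: cmeasurableM; first by case: (lg i).
    by apply: (cmeasurable_translate lcG); case: (lf i).
  split.
    rewrite (convE lcG); under eq_fun do rewrite (convE lcG).
    by apply: part => //; [exact: Re_realM|exact: Re_le_cabs].
  rewrite (convE lcG); under eq_fun do rewrite (convE lcG).
  by apply: part => //; [exact: Im_realM|exact: Im_le_cabs].
(* Domination by the costs supplies the absolute convergence with which [series_pair] flattens the
   double series. *)
have summ (h : nat -> nat -> R) : (forall i k, `|h i k| <= NF i k * NH i k) ->
    (\sum_(i <oo) \sum_(k <oo) `|h i k|%:E < +oo)%E.
  move=> hle; apply: le_lt_trans (le_lt_trans tot (ltry c)).
  apply: lee_nneseries => [i _ _|i _].
    by apply: nneseries_ge0 => k _ _; rewrite lee_fin.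
  by apply: lee_nneseries => [k _ _|k _]; rewrite lee_fin.
have lF i k : inLp mu p (F i k) by case: (lfA i) => + _; exact.
have lH i k : inLp mu q (H i k) by case: (lgK i) => + _; exact.
have cle i k z := conv_le lcG haar_mu p0 q0 conj_exp_inv z (lF i k) (lH i k).
have cvgZ (a : R) (u : nat -> R) l : series u @ \oo --> l ->
    series (fun i => a * u i) @ \oo --> a * l.
  move=> ul; rewrite (_ : series _ = fun n => a * series u n); last first.
    by apply/funext => n; rewrite /series /= mulr_sumr.
  by apply: cvgM => //; exact: cvg_cst.
split=> // z; split; rewrite /fmul ?Re_realM ?Im_realM.
- apply: (series_pair sgb (h := fun i k =>
    complex.Re (Defs.conv mul inv mu (H i k) (fvee inv (F i k)) z))).
  + by apply: summ => i k; case: (cle i k z).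
  + by move=> i; case: (convs i z) => + _; exact.
  + by apply: cvgZ; case: (rep z).
- apply: (series_pair sgb (h := fun i k =>
    complex.Im (Defs.conv mul inv mu (H i k) (fvee inv (F i k)) z))).
  + by apply: summ => i k; case: (cle i k z).
  + by move=> i; case: (convs i z) => _; exact.
  + by apply: cvgZ; case: (rep z).
Qed.

End fixed_exponent.

End multipliers.

(** * Point evaluations as bounded functionals *)

Section evaluations.
Context {R : realType} {G : ptopologicalType}.
Context {mul : G -> G -> G} {inv : G -> G} {e : G}.
Context {mu : {measure set (borel G) -> \bar R}}.
Hypothesis lcG : locally_compact_group mul inv e.
Hypothesis haar_mu : left_haar_measure mul mu.
Context {p : R}.
Hypothesis p1 : 1 < p.
Local Notation "x ** y" := (mul x y) (at level 40, left associativity).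
Local Notation q := (conj_exp p).

Let p0 : 0 < p. Proof. exact: lt_trans p1. Qed.
Let q0 : 0 < q. Proof. exact: lt_trans (conj_exp_gt1 p1). Qed.

Let cost (fs gs : nat -> G -> R[i]) i : R :=
  fine (Lpnorm mu p (fs i)) * fine (Lpnorm mu q (gs i)).

Let cost_ge0 fs gs i : 0 <= cost fs gs i.
Proof. by rewrite mulr_ge0// fine_ge0// Lpnorm_ge0. Qed.

(** The factor 2 comes from bounding the real and the imaginary part separately. *)
Lemma Ap_rep_cabs_le v fs gs x : Ap_rep mul inv mu p v fs gs ->
  cabs (v x) <= 2 * limn (series (cost fs gs)).
Proof.
move=> [lf lg ccost rep].
have bound (u : nat -> R) l : series u @ \oo --> l ->
    (forall i, `|u i| <= cost fs gs i) -> `|l| <= limn (series (cost fs gs)).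
  move=> ul uc; rewrite -(cvg_lim _ ul)//.
  have cu : cvgn [normed series u].
    by apply: (series_le_cvg _ _ uc ccost).
  apply: le_trans (lim_series_norm cu) _.
  exact: lim_series_le.
have [re im] := rep x.
have cle i := conv_le lcG haar_mu p0 q0 (conj_exp_inv p1) x (lf i) (lg i).
apply: le_trans (cabs_le _) _; rewrite mulr2n mulrDl mul1r; apply: lerD.
  by apply: (bound _ _ re) => i; case: (cle i).
by apply: (bound _ _ im) => i; case: (cle i).
Qed.

Lemma cabs_le_Ap_norm v x : inAp mul inv mu p v ->
  cabs (v x) <= 2 * Ap_norm mul inv mu p v.
Proof.
move=> [fs [gs rep]]; rewrite mulrC -ler_pdivrMr//; apply: lb_le_inf.
  by exists (limn (series (cost fs gs))), fs, gs.
move=> _ [fs' [gs' [rep' ->]]]; rewrite ler_pdivrMr// mulrC.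
exact: Ap_rep_cabs_le.
Qed.

Lemma Ap_norm_le v fs gs : Ap_rep mul inv mu p v fs gs ->
  Ap_norm mul inv mu p v <= limn (series (cost fs gs)).
Proof.
move=> rep; apply: ge_inf; last by exists fs, gs.
exists 0 => _ [fs' [gs' [[_ _ c' _] ->]]].
by apply: limr_ge => //; apply: nearW => n; apply: sumr_ge0 => i _; exact: cost_ge0.
Qed.

Lemma Ap_norm_factorizable (r : G -> R) v : factorizable (mul := mul) (inv := inv) (p := p) r ->
  inAp mul inv mu p v ->
  inAp mul inv mu p (fmul (fun x => (r x)%:C%C) v) /\
  Ap_norm mul inv mu p (fmul (fun x => (r x)%:C%C) v) <= Ap_norm mul inv mu p v.
Proof.
move=> fac [fs [gs rep]]; split.
  have [fs' [gs' [rep' _]]] := Ap_rep_factorizable lcG haar_mu p1 fac rep.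
  by exists fs', gs'.
apply: lb_le_inf; first by exists (limn (series (cost fs gs))), fs, gs.
move=> _ [fs1 [gs1 [rep1 ->]]].
have [fs' [gs' [rep' le']]] := Ap_rep_factorizable lcG haar_mu p1 fac rep1.
exact: le_trans (Ap_norm_le rep') le'.
Qed.

Lemma factorizable_Bp (r : G -> R) : factorizable (mul := mul) (inv := inv) (p := p) r ->
  continuous r -> (exists M, forall x, `|r x| <= M) ->
  inBp mul inv mu p (fun x => (r x)%:C%C) /\
  (Bp_norm mul inv mu p (fun x => (r x)%:C%C) <= 1)%E.
Proof.
move=> fac cr [M rM]; split.
  split=> //=.
  - by move=> x; exact: cvg_cst.
  - by exists M => x; rewrite cabs_real.
  - by move=> v /(Ap_norm_factorizable fac)[].
apply: ge_ereal_sup => _ [v [Av v1] <-]; rewrite lee_fin.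
by apply: le_trans v1; case: (Ap_norm_factorizable fac Av).
Qed.

Lemma Lpnorm_normalized_indic (r : R) (S : set (borel G)) : 0 < r -> measurable S ->
  mu S \is a fin_num -> 0 < fine (mu S) ->
  let f x := ((fine (mu S)) `^ (- r^-1) * \1_S x)%:C%C in
  inLp mu r f /\ Lpnorm mu r f = 1%E.
Proof.
move=> r0 mS Sfin S0 f; set m := fine (mu S) in S0 f *.
have mf : cmeasurable f.
  by apply: cmeasurable_real; apply: measurable_funM.
have : (Lpnorm mu r f `^ r = 1)%E.
  rewrite Lpnorm_powR//.
  rewrite (eq_integral (fun x : borel G => ((m^-1)%:E * (\1_S x)%:E)%E)); last first.
    move=> x _; rewrite /f cabs_real ger0_norm ?mulr_ge0 ?powR_ge0// -EFinM indicE.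
    have [xS|xS] := boolP (x \in S); last by rewrite !mulr0 powR0// gt_eqF.
    by rewrite !mulr1 -powRrM mulNr mulVf ?gt_eqF// powR_inv1// ltW.
  rewrite ge0_integralZl_EFin ?invr_ge0 ?(ltW S0)//; last first.
    by apply/measurable_EFinP; exact: measurable_indic.
  by rewrite integral_indic// setIT -[mu S]fineK// -EFinM mulVf// gt_eqF.
move=> fr; have f1 : Lpnorm mu r f = 1%E.
  have : ((Lpnorm mu r f `^ r) `^ r^-1 = 1)%E by rewrite fr poweR1r.
  by rewrite -poweRrM mulfV ?gt_eqF// poweRe1// Lpnorm_ge0.
by split => //; split=> //; rewrite f1 ltry.
Qed.

(** Convolve the indicator of [xV], normalized in L^q, with the reflected indicator of [V],
    normalized in L^p. The cost is 1, and at [x] the integrand is the indicator of [xV] divided by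
    [mu V]. Zero functions fill up the representation. *)
Lemma exists_Ap_nonzero x : exists v,
  [/\ inAp mul inv mu p v, Ap_norm mul inv mu p v <= 1 & v x = 1].
Proof.
have [V [cV eV _]] := compact_nbhs_in lcG (@filterT _ (nbhs e) _).
have mV : measurable (V : set (borel G)) by exact: (borel_compact lcG).
have Vfin := compact_mu_fin haar_mu cV.
have V0 := compact_nbhs_mu_gt0 lcG haar_mu cV eV.
set m := fine (mu V) in V0.
pose W : set (borel G) := mul (inv x) @^-1` V.
have mW : measurable W by exact: (measurable_translate lcG).
have muW : mu W = mu V by exact: (haar_preimage lcG haar_mu).
have [lf f1] := Lpnorm_normalized_indic p0 mV Vfin V0.
have := Lpnorm_normalized_indic q0 mW; rewrite muW => /(_ Vfin V0)[lg g1].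
rewrite -/m in lf f1 lg g1.
set f := (fun x => (_ `^ (- p^-1) * _)%:C%C) in lf f1.
set g := (fun x => (_ `^ (- q^-1) * _)%:C%C) in lg g1.
pose fs i := if i is 0 then f else (fun _ : G => 0 : R[i]).
pose gs i := if i is 0 then g else (fun _ : G => 0 : R[i]).
have norm0 (r : R) : 0 < r -> Lpnorm mu r (fun _ : G => 0 : R[i]) = 0%E.
  move=> r0; rewrite -(Lnorm0 mu (p := r%:E)) ?eqe ?gt_eqF//.
  by apply: eq_Lnorm => y /=; rewrite cabs0.
have lp0 (r : R) : 0 < r -> inLp mu r (fun _ : G => 0 : R[i]).
  by move=> r0; split; [split; exact: measurable_cst|rewrite norm0].
have series_head (u : nat -> R) : (forall i, u i.+1 = 0) -> series u @ \oo --> u 0%N.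
  move=> u0; apply: cvg_near_cst; exists 1%N => // -[//|n] _ /=.
  by rewrite /series /= big_nat_recl// big1 ?addr0.
have R0 : Rintegral mu [set: borel G] (fun _ => 0) = 0 by rewrite /Rintegral integral0.
have convV z : Defs.conv mul inv mu g (fvee inv f) z =
    cintegral mu (fun y => g y * f (inv z ** y)) by exact: (convE lcG).
have conv0 z i : Defs.conv mul inv mu (gs i.+1) (fvee inv (fs i.+1)) z = 0.
  rewrite (convE lcG) (_ : (fun y => _) = fun _ => 0); last first.
    by apply/funext => y; rewrite mul0r.
  by rewrite /cintegral /= R0.
have rep : Ap_rep mul inv mu p (Defs.conv mul inv mu g (fvee inv f)) fs gs.
  split.
  - by case=> [|i] //; exact: lp0.
  - by case=> [|i] //; exact: lp0.
  - apply/cvg_ex; exists (cost fs gs 0); apply: series_head => i.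
    by rewrite /= norm0// mul0r.
  - move=> z; split.
      by apply: (series_head (fun i => complex.Re
        (Defs.conv mul inv mu (gs i) (fvee inv (fs i)) z))) => i; rewrite conv0.
    by apply: (series_head (fun i => complex.Im
      (Defs.conv mul inv mu (gs i) (fvee inv (fs i)) z))) => i; rewrite conv0.
exists (Defs.conv mul inv mu g (fvee inv f)); split; first by exists fs, gs.
- apply: le_trans (Ap_norm_le rep) _.
  have -> : limn (series (cost fs gs)) = cost fs gs 0.
    apply: cvg_lim => //; apply: series_head => i.
    by rewrite /cost /= norm0// mul0r.
  by rewrite /cost /= f1 g1 mulr1.
- have gf y : g y * f (inv x ** y) = (m^-1 * \1_W y)%:C%C.
    rewrite /g /f -rmorphM /=; congr (_%:C)%C.
    have -> : \1_V (inv x ** y) = \1_W y :> R by rewrite !indicE.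
    rewrite mulrACA -powRD; last by rewrite implybE (gt_eqF V0) orbT.
    rewrite -opprD addrC (conj_exp_inv p1) powR_inv1 ?(ltW V0)// indicE -natrM mulnb andbb//.
  rewrite convV (_ : (fun y => _) = fun y => (m^-1 * \1_W y)%:C%C); last exact/funext.
  rewrite /cintegral /= R0 /Rintegral.
  rewrite (eq_integral (fun y : borel G => ((m^-1)%:E * (\1_W y)%:E)%E))//.
  rewrite ge0_integralZl_EFin ?invr_ge0 ?(ltW V0)//; last first.
    by apply/measurable_EFinP; exact: measurable_indic.
  by rewrite integral_indic// setIT muW -[mu V]fineK// -EFinM mulVf// gt_eqF.
Qed.

(** If [v x = 1] and [v] has norm at most 1, then [u x] is the value at [x] of [u v], an element of
    [A_p] of norm at most that of [u]. *)
Lemma Bp_dual_eval x : Bp_dual mul inv mu p (fun u => u x).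
Proof.
split=> //; exists 2 => u [_ _ _ uA].
have [v [Av v1 vx]] := exists_Ap_nonzero x.
apply: (@le_trans _ _ (2%:E * (Ap_norm mul inv mu p (fmul u v))%:E)%E).
  rewrite -EFinM lee_fin; have := cabs_le_Ap_norm x (uA _ Av).
  by rewrite /fmul vx mulr1.
apply: lee_wpmul2l; first by rewrite lee_fin.
by apply: ereal_sup_ubound; exists v.
Qed.

End evaluations.

(** * Separation of evaluations *)

Section separation.
Context {R : realType} {G : ptopologicalType}.
Context {mul : G -> G -> G} {inv : G -> G} {e : G}.
Context {mu : {measure set (borel G) -> \bar R}}.
Hypothesis lcG : locally_compact_group mul inv e.
Hypothesis haar_mu : left_haar_measure mul mu.
Context {p : R}.
Hypothesis p1 : 1 < p.
Local Notation "x ** y" := (mul x y) (at level 40, left associativity).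
Local Notation q := (conj_exp p).

Let p0 : 0 < p. Proof. exact: lt_trans p1. Qed.
Let q0 : 0 < q. Proof. exact: lt_trans (conj_exp_gt1 p1). Qed.

Lemma translated_average_continuous (a : G -> R) (B : set G) :
  continuous a -> (forall s, 0 <= a s <= 1) -> compact B ->
  continuous (fun z => Rintegral mu (B : set (borel G)) (fun t => a (inv z ** t))).
Proof.
move=> ca a01 cB z; have mB : measurable (B : set (borel G)) by exact: (borel_compact lcG).
have Bfin := compact_mu_fin haar_mu cB.
have B0 : 0 <= fine (mu B) by exact: fine_ge0.
have mtr x : measurable_fun (B : set (borel G)) (fun t : borel G => a (inv x ** t)).
  apply: measurable_funTS; apply: continuous_borel => t.
  apply: (@continuous_comp _ _ _ (mul (inv x)) a); last exact: ca.
  exact: (lmul_continuous lcG).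
have intc (c : R) : mu.-integrable (B : set (borel G)) (EFin \o cst c : borel G -> \bar R).
  apply/integrableP; split.
    by apply/measurable_EFinP; exact: measurable_cst.
  by rewrite /= integral_cst// lte_mul_pinfty// ltey_eq Bfin.
have int x : mu.-integrable (B : set (borel G))
    (EFin \o (fun t => a (inv x ** t)) : borel G -> \bar R).
  apply: le_integrable (intc 1) => //; first exact/measurable_EFinP.
  by move=> t _ /=; have /andP[a0 a1] := a01 (inv x ** t); rewrite lee_fin normr1 ger0_norm.
apply/cvgrPdist_le => eps eps0.
(* The added 1 keeps the denominator positive even if [mu B = 0]. *)
pose d := eps / (fine (mu B) + 1).
have d0 : 0 < d by rewrite divr_gt0// ltr_wpDl.
have : \forall x \near z, forall t, B t -> `|a (inv z ** t) - a (inv x ** t)| <= d.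
  apply: (proj1 (compact_near_coveringP B) cB _ (nbhs z)
    (fun x t => `|a (inv z ** t) - a (inv x ** t)| <= d) _) => t Bt.
  have c1 : (fun xt : G * G => a (inv z ** xt.1)) @ (nbhs t, nbhs z) --> a (inv z ** t).
    apply: (@cvg_comp _ _ _ (fun xt : G * G => inv z ** xt.1) a); last exact: ca.
    by apply: (mul_cvg lcG); [exact: cvg_cst|exact: cvg_fst].
  have c2 : (fun xt : G * G => a (inv xt.2 ** xt.1)) @ (nbhs t, nbhs z) --> a (inv z ** t).
    apply: (@cvg_comp _ _ _ (fun xt : G * G => inv xt.2 ** xt.1) a); last exact: ca.
    apply: (mul_cvg lcG); last exact: cvg_fst.
    by apply: (inv_cvg lcG); exact: cvg_snd.
  have c12 : (fun xt : G * G => a (inv z ** xt.1) - a (inv xt.2 ** xt.1)) @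
      (nbhs t, nbhs z) --> (0 : R).
    by rewrite -(subrr (a (inv z ** t))); exact: cvgB.
  exact: (proj1 (cvgr0Pnorm_le _) c12 d d0).
apply: filterS => x near_x; rewrite -RintegralB//.
apply: (@le_trans _ _ (Rintegral mu (B : set (borel G)) (cst d))).
  have intB : mu.-integrable (B : set (borel G))
      (EFin \o (fun t => a (inv z ** t) - a (inv x ** t)) : borel G -> \bar R).
    exact: (integrableB mB (int z) (int x)).
  apply: le_trans (le_normr_Rintegral mB intB) _.
  by apply: (le_Rintegral mB (integrable_norm intB) (intc d)) => t Bt; exact: near_x.
rewrite Rintegral_cst// /d -mulrA ler_piMr ?(ltW eps0)//.
by rewrite mulrC ler_pdivrMr ?ltr_wpDl// mul1r lerDl.
Qed.

(** Both [w x] and the normalizing factor [alpha * beta] are proportional to [mu V], so [V] may be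
    as small as the separation of [x] and [y] demands without spoiling the constant. *)
Lemma separating_multiplier (x y : G) : x <> y -> exists r : G -> R,
  [/\ inBp mul inv mu p (fun z => (r z)%:C%C),
      (Bp_norm mul inv mu p (fun z => (r z)%:C%C) <= 1)%E,
      16^-1 <= r x & r y = 0].
Proof.
move=> xy; have [N [oN Ne Nxy]] := disjoint_translates lcG xy.
have [V [cV eV VN]] := compact_nbhs_in lcG (open_nbhs_nbhs (conj oN Ne)).
have mV : measurable (V : set (borel G)) by exact: (borel_compact lcG).
have Vfin := compact_mu_fin haar_mu cV.
have m0 := compact_nbhs_mu_gt0 lcG haar_mu cV eV.
set m := fine (mu V) in m0.
have [|U0 [oU0 VU0 U0m]] := outer_open haar_mu mV _ m0; first by rewrite ltey_eq Vfin.
pose U := U0 `&` N.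
have oU : open U by exact: openI.
have mU := borel_open oU.
have muU : (mu U <= (2 * m)%:E)%E.
  apply: (@le_trans _ _ (mu U0)).
    apply: le_measure; rewrite ?inE//; first exact: borel_open.
    exact: subIsetl.
  by apply: (le_trans (ltW U0m)); rewrite -(fineK Vfin) -/m -EFinD mulr2n mulrDl mul1r.
have VU : V `<=` U by move=> z Vz; split; [exact: VU0|exact: VN].
have [a [a01 aV aunif asupp]] := smooth_indicator lcG haar_mu cV oU VU.
have ca := right_uniform_continuous lcG aunif.
pose B : set G := [set x ** v | v in V].
have cB : compact B.
  by apply: continuous_compact => //; apply: continuous_subspaceT; exact: (lmul_continuous lcG).
have mB : measurable (B : set (borel G)) by exact: (borel_compact lcG).
have muB : mu B = mu V by case: haar_mu => + _ _ _ _; exact.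
pose w z := Rintegral mu (B : set (borel G)) (fun t => a (inv z ** t)).
(* Roots of the bounds of [kernel_factorization]: [2 * mu U <= 4 * m] for the first factor, and
   [mu B = m] for the second. *)
pose alpha := (4 * m) `^ p^-1; pose beta := (2 `^ q * 2 * m) `^ q^-1.
have q20 : 0 < 2 `^ q * 2 * m by rewrite !mulr_gt0// powR_gt0.
have alpha0 : 0 < alpha by rewrite powR_gt0// mulr_gt0.
have beta0 : 0 < beta by rewrite powR_gt0.
have invpow (c t : R) : 0 < c -> 0 < t -> (c `^ t^-1)^-1 `^ t = c^-1.
  move=> c0 t0; rewrite -powRN -powRrM mulNr mulVf ?gt_eqF//.
  by rewrite powR_inv1// ltW.
have ma z : measurable_fun [set: borel G] (fun t : borel G => a (inv z ** t)).
  apply: continuous_borel => t.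
  apply: (@continuous_comp _ _ _ (mul (inv z)) a); last exact: ca.
  exact: (lmul_continuous lcG).
have wfin z : (\int[mu]_(t in (B : set (borel G))) (a (inv z ** t))%:E = (w z)%:E)%E.
  rewrite fineK// ge0_fin_numE; last first.
    by apply: integral_ge0 => t _; rewrite lee_fin; have /andP[] := a01 (inv z ** t).
  apply: (@le_lt_trans _ _ (\int[mu]_(t in (B : set (borel G))) (cst 1%E t))%E).
    apply: ge0_le_integral => //.
    - by move=> t _; rewrite lee_fin; have /andP[] := a01 (inv z ** t).
    - by apply/measurable_EFinP; apply: measurable_funTS.
    - by move=> t _; rewrite lee_fin; have /andP[] := a01 (inv z ** t).
  by rewrite integral_cst// mul1e muB ltey_eq Vfin.
pose r z := w z / (alpha * beta).
have fac : factorizable (mul := mul) (inv := inv) (p := p) r.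
  move=> C cC.
  have [A [K [HA HK sA sK AK]]] := kernel_factorization lcG haar_mu p1 (conj_exp_gt1 p1)
    (conj_exp_inv p1) a01 aunif asupp oU cB cC.
  exists (fun k s => A k s / alpha), (fun k z => K k z / beta); split.
  - move=> k; case: (HA k) => A0 mA; split=> [s|]; first by rewrite divr_ge0// ltW.
    exact: measurable_funM.
  - move=> k; case: (HK k) => K0 mK; split=> [s|]; first by rewrite divr_ge0// ltW.
    exact: measurable_funM.
  - move=> s.
    rewrite (eq_eseriesr (g := fun k => ((4 * m)^-1)%:E * (A k s `^ p)%:E)%E); last first.
      move=> k _; case: (HA k) => A0 _; rewrite powRM ?invr_ge0 ?(ltW alpha0)//.
      rewrite -EFinM mulrC; congr (_ * _)%:E.
      by apply: invpow => //; rewrite mulr_gt0.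
    rewrite nneseriesZl; last by move=> k _; rewrite lee_fin powR_ge0.
    rewrite muleC lee_pdivrMr ?mulr_gt0// mul1e; apply: (le_trans (sA s)).
    apply: (@le_trans _ _ (2%:E * (2 * m)%:E)%E); first exact: lee_wpmul2l.
    by rewrite -EFinM lee_fin mulrA -natrM.
  - move=> s.
    rewrite (eq_eseriesr (g := fun k => ((2 `^ q * 2 * m)^-1)%:E * (K k s `^ q)%:E)%E); last first.
      move=> k _; case: (HK k) => K0 _; rewrite powRM ?invr_ge0 ?(ltW beta0)//.
      rewrite -EFinM mulrC; congr (_ * _)%:E.
      exact: invpow.
    rewrite nneseriesZl; last by move=> k _; rewrite lee_fin powR_ge0.
    rewrite muleC lee_pdivrMr// mul1e; apply: (le_trans (sK s)).
    by rewrite muB -(fineK Vfin) -/m -EFinM.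
  - move=> n s z Cs.
    rewrite (eq_eseriesr (g := fun k =>
      ((alpha * beta)^-1)%:E * (A k (inv z ** s) * K k s)%:E)%E); last first.
      by move=> k _; rewrite -EFinM; congr (_%:E); rewrite invfM mulrACA mulrC.
    rewrite nneseriesZl; last first.
      by move=> k _; rewrite lee_fin mulr_ge0//; [case: (HA k)|case: (HK k)].
    rewrite (AK n)// /r EFinM -wfin muleC; congr (_ * _)%E.
    (* Left invariance identifies the integral over [s^-1 B] with the one over [B], which is free of
       [s]; extension by zero lets the translation act on all of [G]. *)
    rewrite [LHS]integral_mkcond [RHS]integral_mkcond.
    rewrite -[RHS](haar_integral lcG haar_mu s); last first.
      apply: (proj1 (measurable_restrictT _ mB)).
      by apply/measurable_EFinP; exact: measurable_funTS.
    apply: eq_integral => t _; rewrite /patch /=.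
    rewrite (_ : (t \in mul s @^-1` B) = (s ** t \in B)); last first.
      by apply/idP/idP => /set_mem Bt; exact/mem_set.
    by case: ifP => // _; rewrite (gmulA lcG).
have cr : continuous r.
  move=> z; apply: cvgM; last exact: cvg_cst.
  exact: (translated_average_continuous ca a01 cB).
have r0 z : 0 <= r z.
  rewrite divr_ge0 ?mulr_ge0 ?(ltW alpha0) ?(ltW beta0)//.
  by apply: Rintegral_ge0 => t _; have /andP[] := a01 (inv z ** t).
have w_le z : w z <= m.
  rewrite -lee_fin -wfin fineK// -muB.
  apply: (@le_trans _ _ (\int[mu]_(t in (B : set (borel G))) (cst 1%E t))%E).
    apply: ge0_le_integral => //.
    - by move=> t _; rewrite lee_fin; have /andP[] := a01 (inv z ** t).
    - by apply/measurable_EFinP; apply: measurable_funTS.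
    - by move=> t _; rewrite lee_fin; have /andP[] := a01 (inv z ** t).
  by rewrite integral_cst// mul1e.
have br : exists M, forall z, `|r z| <= M.
  exists (m / (alpha * beta)) => z; rewrite ger0_norm// ler_pM2r//.
  by rewrite invr_gt0 mulr_gt0.
have [rBp r1] := factorizable_Bp lcG haar_mu p1 fac cr br.
exists r; split=> //.
- have wx : w x = m.
    apply: EFin_inj; rewrite -wfin fineK// -muB.
    rewrite (eq_integral (cst 1%E)) ?integral_cst ?mul1e// => t /set_mem[v Vv <-].
    by rewrite (gmulK lcG) aV.
  rewrite /r wx ler_pdivlMr ?mulr_gt0//.
  (* As [1/p + 1/q = 1], the powers of [m] combine into one factor [m]; the remaining constant is at
     most [4 * (2 * 2) = 16]. *)
  have -> : alpha * beta = 4 `^ p^-1 * (2 * 2 `^ q^-1) * m.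
    rewrite /alpha /beta !powRM ?mulr_ge0 ?powR_ge0 ?(ltW m0)//.
    rewrite -powRrM mulfV ?gt_eqF// powRr1// mulrACA.
    rewrite -powRD ?(conj_exp_inv p1) ?powRr1 ?(ltW m0)//.
    by rewrite implybE oner_eq0.
  have le4 : 4 `^ p^-1 <= 4 :> R.
    by apply: ler1_powR; rewrite ?ler1n// invf_le1// ltW.
  have le2 : 2 `^ q^-1 <= 2 :> R.
    by apply: ler1_powR; rewrite ?ler1n// invf_le1// ltW// (conj_exp_gt1 p1).
  rewrite [leLHS]mulrA; apply: ler_piMl; first exact: ltW.
  rewrite ler_pdivrMl// mulr1.
  have -> : 16 = 4 * (2 * 2) :> R by rewrite -!natrM.
  by apply: ler_pM; rewrite ?mulr_ge0 ?powR_ge0// ler_pM2l.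
- have Ua s : a s != 0 -> U s.
    by move=> as0; have := nbhs_singleton asupp; move=> /(_ s as0); rewrite (gmulr1 lcG).
  (* If [a] were nonzero at [y^-1 x v], that point would be in [N], and [x v] would lie in both [xN]
     and [yN]. *)
  have wy : w y = 0.
    apply: EFin_inj; rewrite -wfin (eq_integral (cst 0%E)) ?integral0//.
    move=> t /set_mem[v Vv <-] /=; congr (_%:E).
    apply/eqP; apply: contraT => /Ua[_ Ns]; exfalso.
    by apply: (Nxy v (inv y ** (x ** v)) (VN _ Vv) Ns); rewrite (gmulVK lcG).
  by rewrite /r wy mul0r.
Qed.

End separation.

(** * From separability to countability to discreteness *)

Section discreteness.
Context {R : realType} {G : ptopologicalType}.
Context {mul : G -> G -> G} {inv : G -> G} {e : G}.
Context {mu : {measure set (borel G) -> \bar R}}.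
Hypothesis lcG : locally_compact_group mul inv e.
Hypothesis haar_mu : left_haar_measure mul mu.
Local Notation "x ** y" := (mul x y) (at level 40, left associativity).

Lemma Bp_dual_separable_countable (p : R) : 1 < p -> Bp_dual_separable mul inv mu p ->
  exists n : G -> nat, injective n.
Proof.
move=> p1 [D [_ Ddense]].
(* Two points with the same approximant have values of [r] within [2/64] of each other, less than
   the gap [1/16]. *)
have eps0 : 0 < 64^-1 :> R by rewrite invr_gt0.
have /choice[n nP] x : exists k,
    (Bp_dual_dist mul inv mu p (fun u => u x) (D k) <= (64^-1)%:E)%E.
  exact: Ddense (Bp_dual_eval lcG haar_mu p1 x) _ eps0.
exists n => x y nxy; apply: contrapT => xy.
have [r [rB r1 rx ry]] := separating_multiplier lcG haar_mu p1 xy.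
have near z : `|r z - complex.Re (D (n z) (fun z => (r z)%:C%C))| <= 64^-1.
  rewrite -lee_fin; apply: le_trans (nP z).
  apply: (@le_trans _ _ (cabs ((r z)%:C%C - D (n z) (fun z => (r z)%:C%C)))%:E).
    rewrite lee_fin; apply: le_trans (Re_le_cabs _).
    by rewrite raddfB.
  by apply: ereal_sup_ubound; exists (fun z => (r z)%:C%C).
have := near x; have := near y; rewrite nxy ry.
set t := complex.Re _; rewrite !ler_norml => /andP[y2 _] /andP[_ x2].
lra.
Qed.

Lemma countable_discrete (n : G -> nat) : injective n -> discrete_group G.
Proof.
move=> n_inj.
have cpt1 x : compact [set x : G] by exact: compact_set1.
have m1 x : measurable ([set x] : set (borel G)) by exact: (borel_compact lcG).
have mu1 x : mu [set x] = mu [set e].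
  rewrite -(haar_preimage lcG haar_mu x (m1 x)); congr (mu _).
  apply/seteqP; split=> z /= => [xz|->]; last exact: (gmulr1 lcG).
  by apply: (gmulI lcG (x := x)); rewrite (gmulr1 lcG).
have e0 : mu [set e] != 0%E.
  (* If points were null, the countable group would be null, whereas nonempty open sets have
     positive measure. *)
  apply/eqP => mue0.
  have : mu.-negligible (\bigcup_k [set x : borel G | n x = k]).
    apply: negligible_bigcup => k.
    have [[x nx]|nk] := pselect (exists x, n x = k).
      exists [set x]; split; [exact: m1|by rewrite mu1|].
      by move=> z /= nz; apply: n_inj; rewrite nz nx.
    exists set0; split => // z nz; apply: nk; by exists z.
  rewrite (_ : \bigcup_k _ = setT); last by apply/seteqP; split => // x _; exists (n x).
  move=> /(measure_negligible measurableT) muT.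
  case: haar_mu => _ _ pos _ _.
  by have := pos setT openT (ex_intro _ e I); rewrite muT ltxx.
pose c := fine (mu [set e]).
have efin := compact_mu_fin haar_mu (cpt1 e).
have c0 : 0 < c by rewrite lt0r fine_ge0// andbT fine_eq0.
have eoo : (mu [set e] < +oo)%E by rewrite ltey_eq efin.
(* [U] has measure below [2 * c], too little for a second point of mass [c]. *)
have [U [oU eU UE]] := outer_open haar_mu (m1 e) eoo c0.
have Ue : U = [set e].
  apply/seteqP; split=> // x Ux; apply: contrapT => xe.
  have : (mu ([set e] `|` [set x]) <= mu U)%E.
    apply: le_measure; rewrite ?inE//; [exact: measurableU|exact: borel_open|].
    by move=> z [/eU|->].
  have -> : mu ([set e] `|` [set x]) = (mu [set e] + c%:E)%E.
    rewrite measureU//; first by rewrite /c fineK//; congr (_ + _)%E; exact: mu1.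
    by apply/seteqP; split => // z [-> ex]; apply: xe.
  by rewrite leNgt UE.
move=> x; rewrite (_ : [set x] = mul (inv x) @^-1` U).
  by apply: open_comp => // z _; exact: (lmul_continuous lcG).
rewrite Ue; apply/seteqP; split => z /= => [->|xz]; first exact: (gmulV lcG).
by apply: (gmulI lcG (x := inv x)); rewrite (gmulV lcG).
Qed.

End discreteness.

Theorem theorem3p4 (R : realType) (G : ptopologicalType)
  (mul : G -> G -> G) (inv : G -> G) (e : G)
  (mu : {measure set (borel G) -> \bar R}) (p : R) :
  locally_compact_group mul inv e ->
  left_haar_measure mul mu ->
  1 < p ->
  Bp_dual_separable mul inv mu p ->
  discrete_group G.
Proof.
move=> lcG haar_mu p1 sepB.
have [n n_inj] := Bp_dual_separable_countable lcG haar_mu p1 sepB.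
exact: (countable_discrete lcG haar_mu n_inj).
Qed.
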